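(* Let $I$ be a totally ordered set, let $\mathcal{K}$ be a filtration of topological spaces indexed by $I$, and let $n$ be a homological degree. Suppose that the homology groups $H_{n-1}(\mathcal{K}_a;\mathbb{Z})$ and $H_n(\mathcal{K}_a;\mathbb{Z})$ are free and finitely generated for all $a\in I$. For a field $F$ and any $a\le b$ in $I$, consider the commutative diagram with rows $$H_n(\mathcal{K}_a;\mathbb{Z})\xrightarrow{( * )}H_n(\mathcal{K}_a;\mathbb{Z})\otimes F\xrightarrow{(\dagger)}H_n(\mathcal{K}_a;F),$$ $$H_n(\mathcal{K}_b;\mathbb{Z})\xrightarrow{( * )}H_n(\mathcal{K}_b;\mathbb{Z})\otimes F\xrightarrow{(\dagger)}H_n(\mathcal{K}_b;F),$$ whose vertical maps (from the first row to the second) are induced by the inclusion $\mathcal{K}_a\subseteq\mathcal{K}_b$, where the maps $( * )$ are extension of scalars and the maps $(\dagger)$ are the natural maps from the universal coefficient theorem. Then the maps $(\dagger)$ are isomorphisms, and the following are equivalent. (1) The persistence module $H_n(\mathcal{K};\mathbb{Z})$ splits as a direct sum of interval submodules. (2) For all $a\le b$ in $I$, the cokernel of the induced map $H_n(\mathcal{K}_a;\mathbb{Z})\to H_n(\mathcal{K}_b;\mathbb{Z})$ is free. (3) For all $a\le b$ in $I$, the relative homology group $H_n(\mathcal{K}_b,\mathcal{K}_a;\mathbb{Z})$ is free. (4) The persistence diagram $\mathrm{PD}_n^F(\mathcal{K})$ is identical for every coefficient field $F$.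
   Context: A filtration $\mathcal{K}$ indexed by a totally ordered set $I$ is a functor from $I$ (as a poset category) to the category of topological spaces and inclusions. For a coefficient ring $R$ ($\mathbb{Z}$ or a field), $H_n(\mathcal{K};R)$ is the functor $I\to R\text{-Mod}$, $a\mapsto H_n(\mathcal{K}_a;R)$, obtained by composing $\mathcal{K}$ with $n$th homology. A functor $f: I\to R\text{-Mod}$ is called a persistence module. An interval of $I$ is a subset $J\subseteq I$ such that $a,b\in J$, $c\in I$ and $a\le c\le b$ imply $c\in J$. The interval module $h^J$ has $h^J_a=R$ for $a\in J$ and $0$ otherwise, with $h^J(a\le b)=\mathrm{id}_R$ if $a,b\in J$ and $0$ otherwise. An interval submodule is a persistence submodule isomorphic to an interval module, and an interval decomposition is a direct-sum decomposition in which each summand is an interval submodule. For a field $F$, the persistence diagram $\mathrm{PD}_n^F(\mathcal{K})$ is the multiset of (nonempty) intervals corresponding to an interval decomposition of $H_n(\mathcal{K};F)$. *)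

(* Defs.v *)
From HB Require Import structures.
From mathcomp.multinomials Require Import freeg.
From mathcomp Require Import all_boot all_order all_algebra.
From mathcomp Require Import all_classical all_reals.
From mathcomp Require Import topology normedtype.
Set Implicit Arguments.
Unset Strict Implicit.
Unset Printing Implicit Defensive.
Import Order.TTheory GRing.Theory Num.Theory.
Import numFieldNormedType.Exports.
Local Open Scope classical_set_scope.
Local Open Scope quotient_scope.
Local Open Scope ring_scope.

Section ModuleQuotient.
Variables (A : nzRingType) (V : lmodType A) (N : submodClosed V).

Definition submod_mem : V -> bool := fun x => x \in N.

HB.instance Definition _ := GRing.isZmodClosed.Build V submod_mem
  (GRing.submod_closedB (submodClosedP N)).

Definition modquot := Quotient.quot (GRing.ZmodClosed.clone V submod_mem _).
HB.instance Definition _ := GRing.Zmodule.on modquot.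
HB.instance Definition _ := Quotient.on modquot.

Definition modquot_scale (a : A) := lift_op1 modquot ( *:%R a).

Lemma modquotE x y : (\pi_modquot x == \pi_modquot y) = (x - y \in N).
Proof. by rewrite -[LHS]Quotient.idealrBE. Qed.

Lemma modquot_piD : {morph \pi_modquot : x y / x + y}.
Proof. by move=> x y; rewrite [LHS]Quotient.pi_add. Qed.

Lemma modquot_piZ a x : modquot_scale a (\pi_modquot x) = \pi_modquot (a *: x).
Proof.
unlock modquot_scale; apply/eqP; rewrite modquotE -scalerBr rpredZ //.
by rewrite -modquotE reprK.
Qed.

Lemma modquot_scaleA a b x :
  modquot_scale a (modquot_scale b x) = modquot_scale (a * b) x.
Proof. by elim/quotW: x => x; rewrite !modquot_piZ scalerA. Qed.

Lemma modquot_scale1 : left_id 1 modquot_scale.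
Proof. by elim/quotW=> x; rewrite modquot_piZ scale1r. Qed.

Lemma modquot_scaleDr : right_distributive modquot_scale +%R.
Proof.
move=> a; elim/quotW=> x; elim/quotW=> y.
by rewrite -modquot_piD !modquot_piZ scalerDr modquot_piD.
Qed.

Lemma modquot_scaleDl x : {morph modquot_scale^~ x : a b / a + b}.
Proof.
by move=> a b; elim/quotW: x => x; rewrite !modquot_piZ scalerDl modquot_piD.
Qed.

HB.instance Definition _ := GRing.Zmodule_isLmodule.Build A modquot
  modquot_scaleA modquot_scale1 modquot_scaleDr modquot_scaleDl.

Definition modpi (x : V) : modquot := \pi_modquot x.

Lemma modpi_linear : linear modpi.
Proof. by move=> a x y; rewrite /modpi modquot_piD -modquot_piZ. Qed.
HB.instance Definition _ := GRing.isLinear.Build A V modquot _ modpi modpi_linear.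

Lemma modpiW (P : modquot -> Prop) : (forall x, P (modpi x)) -> forall q, P q.
Proof. by move=> h q; elim/quotW: q. Qed.

Lemma modpi_eq x y : (modpi x == modpi y) = (x - y \in N).
Proof. exact: modquotE. Qed.

Section Lift.
Variables (W : lmodType A) (f : {linear V -> W}).
Hypothesis fN : forall x, x \in N -> f x = 0.

Definition modlift of (forall x, x \in N -> f x = 0) :=
  fun q : modquot => f (repr q).

Lemma modliftE x : modlift fN (modpi x) = f x.
Proof.
apply/eqP; rewrite -subr_eq0 -linearB; apply/eqP/fN.
by rewrite -modquotE reprK.
Qed.

Lemma modlift_linear : linear (modlift fN).
Proof.
move=> a; elim/modpiW=> x; elim/modpiW=> y.
by rewrite -linearP !modliftE linearP.
Qed.
HB.instance Definition _ :=
  GRing.isLinear.Build A modquot W _ (modlift fN) modlift_linear.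
End Lift.
End ModuleQuotient.

Arguments modpi {A V} N.

Section Submodules.
Variables (A : nzRingType) (V : lmodType A).

Section Subtype.
Variable N : submodClosed V.

Record submodule := Submodule { submod_val : V; _ : submod_val \in N }.
HB.instance Definition _ := [isSub for submod_val].
HB.instance Definition _ := [Choice of submodule by <:].
HB.instance Definition _ := [SubChoice_isSubLmodule of submodule by <:].
End Subtype.

Section Kernel.
Variables (W : lmodType A) (f : {linear V -> W}).

Definition ker_pred : V -> bool := fun x => f x == 0.
Lemma ker_submod_closed : submod_closed ker_pred.
Proof.
split=> [|a x y]; first by rewrite unfold_in linear0.
by rewrite !unfold_in linearP => /eqP-> /eqP->; rewrite scaler0 addr0.
Qed.
HB.instance Definition _ := GRing.isSubmodClosed.Build A V ker_pred
  (GRing.submod_closed_semi ker_submod_closed).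
Definition kerm := GRing.SubmodClosed.clone A V ker_pred _.

Definition im_pred : W -> bool := fun y => `[< exists x, f x = y >].
Lemma im_submod_closed : submod_closed im_pred.
Proof.
split=> [|a y z]; first by rewrite unfold_in; apply/asboolP; exists 0; rewrite linear0.
rewrite !unfold_in => /asboolP[x <-] /asboolP[x' <-].
by apply/asboolP; exists (a *: x + x'); rewrite linearP.
Qed.
HB.instance Definition _ := GRing.isSubmodClosed.Build A W im_pred
  (GRing.submod_closed_semi im_submod_closed).
Definition imm := GRing.SubmodClosed.clone A W im_pred _.
Definition coker : lmodType A := modquot imm.
End Kernel.

Section Span.
Variable S : set V.
Definition spanm_pred : V -> bool := fun x =>
  `[< forall N : submodClosed V, (forall s, S s -> s \in N) -> x \in N >].
Lemma spanm_submod_closed : submod_closed spanm_pred.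
Proof.
split=> [|a x y]; first by rewrite unfold_in; apply/asboolP=> N _; exact: rpred0.
rewrite !unfold_in => /asboolP xS /asboolP yS; apply/asboolP=> N SN.
by rewrite rpredD ?rpredZ ?xS ?yS.
Qed.
HB.instance Definition _ := GRing.isSubmodClosed.Build A V spanm_pred
  (GRing.submod_closed_semi spanm_submod_closed).
Definition spanm := GRing.SubmodClosed.clone A V spanm_pred _.
Lemma spanmS s : S s -> s \in spanm.
Proof. by move=> Ss; rewrite unfold_in; apply/asboolP=> N; apply. Qed.
End Span.

Definition free_module := exists (B : choiceType) (f : {linear {freeg B / A} -> V}),
  bijective f.

Definition finitely_generated := exists s : seq V, forall x : V,
  exists c : 'I_(size s) -> A, x = \sum_(i < size s) c i *: s`_i.

End Submodules.

Section FreegLift.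
Variables (A : nzRingType) (B : choiceType) (W : lmodType A) (f : B -> W).

Lemma freegW (P : {freeg B / A} -> Prop) :
  P 0 -> (forall a b x, P x -> P (<< a *g b >> + x)) -> forall x, P x.
Proof.
move=> P0 PD x; rewrite -(freeg_sumE x).
by elim: (dom x) => [|b s IHs]; rewrite ?big_nil // big_cons; apply: PD.
Qed.

Lemma freegZ a c b : a *: << c *g b >> = << a * c *g b >> :> {freeg B / A}.
Proof. by apply/eqP/freeg_eqP => b'; rewrite coeffZ !coeffU mulrA. Qed.

Lemma fglift_linear : linear (fglift f).
Proof.
have fB x y : fglift f (x - y) = fglift f x - fglift f y by exact: lift_is_additive.
have f0 : fglift f 0 = 0 by move: (fB 0 0); rewrite !subrr.
have fD x y : fglift f (x + y) = fglift f x + fglift f y.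
  by rewrite -[y in LHS]opprK fB -[- y]sub0r fB f0 sub0r opprK.
move=> a x y; rewrite fD; congr (_ + _).
elim/freegW: x => [|c b x IHx]; first by rewrite !scaler0 f0 scaler0.
by rewrite scalerDr !fD IHx freegZ !liftU scalerDr scalerA.
Qed.
HB.instance Definition _ :=
  GRing.isLinear.Build A {freeg B / A} W _ (fglift f) fglift_linear.
End FreegLift.

Lemma eq_freeg (A : nzRingType) (B : choiceType) (W : lmodType A)
    (f g : {linear {freeg B / A} -> W}) :
  (forall b, f << b >> = g << b >>) -> f =1 g.
Proof.
move=> fg; elim/freegW => [|a b x IHx]; first by rewrite !linear0.
by rewrite !linearD IHx -[a]mulr1 -freegZ !linearZ /= fg.
Qed.

Record complex (A : nzRingType) := Complex {
  chains :> nat -> lmodType A;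
  bd : forall n, {linear chains n.+1 -> chains n};
  bd_bd : forall n x, bd n (bd n.+1 x) = 0
}.
Arguments bd {A} C {n} : rename.

Record chain_map (A : nzRingType) (C D : complex A) := ChainMap {
  cmap :> forall n, {linear C n -> D n};
  cmap_bd : forall n x, cmap n (bd C x) = bd D (cmap n.+1 x)
}.

Section Homology.
Variable A : nzRingType.
Implicit Types C D E : complex A.

(* In degree 0 every chain is a cycle. *)
Definition cycle_pred C n : C n -> bool :=
  match n return C n -> bool with
  | 0 => fun=> true
  | m.+1 => fun x => bd C x == 0
  end.
Lemma cycle_submod_closed C n : submod_closed (@cycle_pred C n).
Proof.
case: n => [|n]; first by split.
split=> [|a x y]; first by rewrite unfold_in /= linear0.
by rewrite !unfold_in /= linearP => /eqP-> /eqP->; rewrite scaler0 addr0.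
Qed.
HB.instance Definition _ C n := GRing.isSubmodClosed.Build A (C n)
  (@cycle_pred C n) (GRing.submod_closed_semi (@cycle_submod_closed C n)).
Definition cycles C n : lmodType A :=
  submodule (GRing.SubmodClosed.clone A (C n) (@cycle_pred C n) _).

Definition boundary_pred C n : cycles C n -> bool :=
  fun z => `[< exists c, bd C c = val z >].
Lemma boundary_submod_closed C n : submod_closed (@boundary_pred C n).
Proof.
split=> [|a y z]; first by rewrite unfold_in; apply/asboolP; exists 0; rewrite !linear0.
rewrite !unfold_in => /asboolP[x xy] /asboolP[x' xz].
by apply/asboolP; exists (a *: x + x'); rewrite !linearP xy xz.
Qed.
HB.instance Definition _ C n := GRing.isSubmodClosed.Build A (cycles C n)
  (@boundary_pred C n) (GRing.submod_closed_semi (@boundary_submod_closed C n)).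
Definition boundaries C n :=
  GRing.SubmodClosed.clone A (cycles C n) (@boundary_pred C n) _.

Definition homology C n : lmodType A := modquot (boundaries C n).
Definition hclass C n : {linear cycles C n -> homology C n} := modpi (boundaries C n).

Section Map.
Variables (C D : complex A) (f : chain_map C D).

Lemma cmap_cycle n (z : cycles C n) : @cycle_pred D n (f n (val z)).
Proof.
case: n z => [//|n] [z /= /eqP dz].
by rewrite -cmap_bd dz linear0.
Qed.

Definition cycles_map n (z : cycles C n) : cycles D n := Submodule (cmap_cycle z).
Lemma cycles_map_linear n : linear (@cycles_map n).
Proof. by move=> a x y; apply/val_inj; rewrite /= !linearP. Qed.
HB.instance Definition _ n := GRing.isLinear.Build A (cycles C n) (cycles D n) _
  (@cycles_map n) (@cycles_map_linear n).

Lemma cycles_map_boundary n (z : cycles C n) :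
  z \in boundaries C n -> (hclass D n \o @cycles_map n) z = 0.
Proof.
rewrite unfold_in => /asboolP[c cz]; apply/eqP.
rewrite -(linear0 (hclass D n)) modpi_eq subr0.
by rewrite unfold_in; apply/asboolP; exists (f _ c); rewrite -cmap_bd cz.
Qed.

Definition homology_map n : {linear homology C n -> homology D n} :=
  modlift (@cycles_map_boundary n).

Lemma homology_mapE n z : homology_map n (hclass C n z) = hclass D n (cycles_map z).
Proof. exact: modliftE. Qed.
End Map.

Lemma homologyW C n (P : homology C n -> Prop) :
  (forall z, P (hclass C n z)) -> forall h, P h.
Proof. exact: modpiW. Qed.

Lemma homology_map_id C (f : chain_map C C) n :
  (forall n x, f n x = x) -> homology_map f n =1 id.
Proof.
move=> fid; elim/homologyW => z; rewrite (homology_mapE f); congr (hclass _ _ _).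
exact/val_inj/fid.
Qed.

Lemma homology_map_comp C D E (f : chain_map C D) (g : chain_map D E)
    (h : chain_map C E) n : (forall n x, h n x = g n (f n x)) ->
  homology_map h n =1 homology_map g n \o homology_map f n.
Proof.
move=> hE; elim/homologyW => z; rewrite -[RHS]/(homology_map g n (homology_map f n _)).
rewrite (homology_mapE f) (homology_mapE g) (homology_mapE h).
by congr (hclass _ _ _); apply/val_inj/hE.
Qed.

Section CokernelComplex.
Variables (C D : complex A) (f : chain_map C D).

Lemma coker_bd_im n y : y \in imm (f n.+1) ->
  (modpi (imm (f n)) \o bd D) y = 0.
Proof.
rewrite unfold_in => /asboolP[x <-]; apply/eqP.
rewrite -(linear0 (modpi (imm (f n)))) modpi_eq subr0.
by rewrite unfold_in; apply/asboolP; exists (bd C x); rewrite cmap_bd.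
Qed.

Definition coker_bd n : {linear coker (f n.+1) -> coker (f n)} :=
  modlift (@coker_bd_im n).

Lemma coker_bdE n y : coker_bd n (modpi _ y) = modpi _ (bd D y).
Proof. exact: modliftE. Qed.

Lemma coker_bd_bd n x : coker_bd n (coker_bd n.+1 x) = 0.
Proof. by elim/modpiW: x => x; rewrite (coker_bdE x) coker_bdE bd_bd linear0. Qed.

Definition coker_complex := Complex coker_bd_bd.
End CokernelComplex.
End Homology.

Section Simplex.
Variable R : realType.

Definition stdsimplex n : set 'rV[R]_n.+1 :=
  [set x | (forall i, 0 <= x 0 i) /\ \sum_i x 0 i = 1].
Arguments stdsimplex : clear implicits.

Definition face_row n (i : 'I_n.+2) (x : 'rV[R]_n.+1) : 'rV[R]_n.+2 :=
  \row_j (if unlift i j is Some k then x 0 k else 0).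

Lemma face_row_lift n i (x : 'rV[R]_n.+1) k : face_row i x 0 (lift i k) = x 0 k.
Proof. by rewrite mxE liftK. Qed.

Lemma face_row_id n i (x : 'rV[R]_n.+1) : face_row i x 0 i = 0.
Proof. by rewrite mxE unlift_none. Qed.

Lemma face_row_simplex n i (x : 'rV[R]_n.+1) :
  stdsimplex n x -> stdsimplex n.+1 (face_row i x).
Proof.
move=> [x0 x1]; split=> [j|].
  by case: (unliftP i j) => [k|] ->; rewrite ?face_row_lift ?face_row_id.
rewrite (bigD1_ord i) //= face_row_id add0r -x1.
by apply: eq_bigr => k _; rewrite face_row_lift.
Qed.

Lemma face_row_continuous n i : continuous (@face_row n i).
Proof.
move=> x U /nbhs_ballP[e e0 eU]; apply/nbhs_ballP; exists e => //= y [_ xy].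
apply: eU; split=> // k j; rewrite !ord1; case: (unliftP i j) => [l|] ->.
  by rewrite !face_row_lift; exact: xy.
by rewrite !face_row_id; exact: ballxx.
Qed.

Definition face n (i : 'I_n.+2) (x : stdsimplex n) : stdsimplex n.+1 :=
  exist _ (face_row i (val x)) (mem_set (face_row_simplex i (set_valP x))).

Lemma face_continuous n i : continuous (@face n i).
Proof.
apply: continuous_comp_initial => x.
exact: (continuous_comp (@initial_continuous _ _ set_val x)
  (@face_row_continuous n i (val x))).
Qed.

HB.instance Definition _ n i := isContinuous.Build _ _ (@face n i) (@face_continuous n i).

Lemma faceC n (i : 'I_n.+2) (j : 'I_n.+3) x : (i < j)%N ->
  face j (face i x) = face (inord i) (face (inord j.-1) x).
Proof.
move=> ij; have j0 : (0 < j)%N by case: (j : nat) ij.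
have i'E : (inord i : 'I_n.+3) = i :> nat by rewrite inordK // ltnS ltnW.
have j'E : (inord j.-1 : 'I_n.+2) = j.-1 :> nat.
  by rewrite inordK // prednK // -ltnS.
apply/val_inj/rowP => k /=.
case: (unliftP j k) => [k'|] ->.
  rewrite face_row_lift; case: (unliftP i k') => [l|] ->.
    rewrite face_row_lift (_ : lift j (lift i l) = lift (inord i) (lift (inord j.-1) l)).
      by rewrite !face_row_lift.
    apply/val_inj; rewrite /= i'E j'E bumpC; congr bump.
      by rewrite /bump leqNgt ij.
    by rewrite /unbump ij subn1.
  rewrite face_row_id (_ : lift j i = inord i) ?face_row_id //.
  by apply/val_inj; rewrite /= i'E /bump leqNgt ij.
have jE : j = lift (inord i) (inord j.-1).
  by apply/val_inj; rewrite /= i'E j'E /bump -ltnS prednK // ij add1n prednK.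
by rewrite face_row_id [X in _ = face_row _ _ _ X]jE face_row_lift face_row_id.
Qed.
End Simplex.
Arguments stdsimplex : clear implicits.

Section SingularHomology.
Variables (R : realType) (A : nzRingType).

Definition sing (X : topologicalType) n := continuousType (stdsimplex R n) X.

Definition sing_face (X : topologicalType) n (s : sing X n.+1) (i : 'I_n.+2) :
  sing X n := s \o @face R n i.

Definition sing_chains X n : lmodType A := {freeg (sing X n) / A}.

Definition sing_bd X n : {linear sing_chains X n.+1 -> sing_chains X n} :=
  fglift (fun s => \sum_(i < n.+2) (-1) ^+ i *: << sing_face s i >>).

Lemma sing_bdU X n (s : sing X n.+1) :
  sing_bd X n << s >> = \sum_(i < n.+2) (-1) ^+ i *: << sing_face s i >>.
Proof. by rewrite /sing_bd /= liftU scale1r. Qed.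

Lemma sing_face_face X n (s : sing X n.+2) (i : 'I_n.+2) (j : 'I_n.+3) :
  (i < j)%N ->
  sing_face (sing_face s j) i = sing_face (sing_face s (inord i)) (inord j.-1).
Proof. by move=> ij; apply/continuousEP => x /=; rewrite faceC. Qed.

Lemma sing_bd_bdU X n (s : sing X n.+2) : sing_bd X n (sing_bd X n.+1 << s >>) = 0.
Proof.
rewrite sing_bdU linear_sum /=.
under eq_bigr do rewrite linearZ /= sing_bdU scaler_sumr.
under eq_bigr do under eq_bigr do rewrite scalerA -exprD.
rewrite pair_bigA /= (bigID (fun p : 'I_n.+3 * 'I_n.+2 => (p.2 < p.1)%N)) /=.
pose h (p : 'I_n.+3 * 'I_n.+2) : 'I_n.+3 * 'I_n.+2 := (inord p.2, inord p.1.-1).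
pose g (p : 'I_n.+3 * 'I_n.+2) : 'I_n.+3 * 'I_n.+2 := (inord p.2.+1, inord p.1).
rewrite [X in _ + X](reindex_onto h g) /=; last first.
  move=> [j i] /=; rewrite -leqNgt => ji.
  have i3 : (i.+1 < n.+3)%N by rewrite ltnS.
  have j2 : (j < n.+2)%N by rewrite (leq_ltn_trans ji).
  by rewrite /h /g /= !inordK //= !inord_val.
have hP p : ~~ ((h p).2 < (h p).1)%N && (g (h p) == p) = (p.2 < p.1)%N.
  case: p => [j i]; rewrite /g /h /=.
  have i3 : (i < n.+3)%N by rewrite ltnS ltnW.
  have j2 : (j.-1 < n.+2)%N by case: (j : nat) (ltn_ord j).
  rewrite !inordK // -leqNgt; case: (posnP j) => [j0|j0].
    rewrite j0 ltn0; apply/negbTE/negP => /andP[_] /eqP[/(congr1 val)].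
    by rewrite /= inordK // j0.
  by rewrite prednK // !inord_val eqxx andbT -ltnS prednK.
set S := (X in X + _); rewrite [X in _ + X](_ : _ = - S) ?subrr //.
rewrite /S -sumrN; apply: eq_big => [p|[j i]] /=; first exact: hP.
rewrite (hP (j, i)) /= => ij; have j0 : (0 < j)%N by case: (j : nat) ij.
have i3 : (i < n.+3)%N by rewrite ltnS ltnW.
have j2 : (j.-1 < n.+2)%N by case: (j : nat) (ltn_ord j).
rewrite -sing_face_face // !inordK // -scaleNr; congr (_ *: _).
by rewrite -[in RHS](prednK j0) addSn exprS mulN1r opprK addnC.
Qed.

Lemma sing_bd_bd X n x : sing_bd X n (sing_bd X n.+1 x) = 0.
Proof.
exact: (eq_freeg (f := sing_bd X n \o sing_bd X n.+1) (g := \0) (@sing_bd_bdU X n)).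
Qed.

Definition singular X : complex A := Complex (@sing_bd_bd X).

Section Map.
Variables (X Y : topologicalType) (f : continuousType X Y).

Definition sing_map_chains n : {linear sing_chains X n -> sing_chains Y n} :=
  fglift (fun s : sing X n => << (f \o s : sing Y n) >>).

Lemma sing_mapU n (s : sing X n) : sing_map_chains n << s >> = << (f \o s : sing Y n) >>.
Proof. by rewrite /sing_map_chains /= liftU scale1r. Qed.

Lemma sing_map_bd n x :
  sing_map_chains n (sing_bd X n x) = sing_bd Y n (sing_map_chains n.+1 x).
Proof.
apply: (eq_freeg (f := sing_map_chains n \o sing_bd X n)
  (g := sing_bd Y n \o sing_map_chains n.+1)) => s /=.
rewrite sing_mapU !sing_bdU linear_sum; apply: eq_bigr => i _.
rewrite linearZ; congr (_ *: _); rewrite /= sing_mapU; congr << _ >>.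
exact/continuousEP.
Qed.

Definition singular_map : chain_map (singular X) (singular Y) :=
  @ChainMap A (singular X) (singular Y) sing_map_chains sing_map_bd.
End Map.

Definition sing_homology (X : topologicalType) n : lmodType A := homology (singular X) n.

Definition sing_homology_map (X Y : topologicalType) (f : continuousType X Y) n :
  {linear sing_homology X n -> sing_homology Y n} :=
  homology_map (singular_map f) n.

(* H_n(Y, X; A) for an inclusion f of X into Y: the homology of the quotient of
   the singular complex of Y by the image of that of X. *)
Definition relative_homology (X Y : topologicalType) (f : continuousType X Y) n : lmodType A :=
  homology (coker_complex (singular_map f)) n.
End SingularHomology.

Section Tensor.
Variables (M : lmodType int) (F : nzRingType).

(* The tensor product of M and F over the integers, presented as a left
   F-module: the free F-module on the symbols m (x) x modulo additivity in each
   variable and a(m (x) x) = m (x) ax. *)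
Definition tensor_rel : set {freeg (M * F) / F} :=
  [set t | exists m m' x, t = << (m + m', x) >> - << (m, x) >> - << (m', x) >>] `|`
  [set t | exists m x x', t = << (m, x + x') >> - << (m, x) >> - << (m, x') >>] `|`
  [set t | exists m a x, t = << (m, a * x) >> - a *: << (m, x) >>].

Definition tensor : lmodType F := modquot (spanm tensor_rel).

Definition tens (m : M) (x : F) : tensor := modpi (spanm tensor_rel) << (m, x) >>.

Definition balanced (W : lmodType F) (phi : M -> F -> W) :=
  [/\ forall m m' x, phi (m + m') x = phi m x + phi m' x,
      forall m x x', phi m (x + x') = phi m x + phi m x'
    & forall m a x, phi m (a * x) = a *: phi m x].

Lemma tens_rel0 t : tensor_rel t -> modpi (spanm tensor_rel) t = 0.
Proof.
move=> tR; apply/eqP; rewrite -(linear0 (modpi (spanm tensor_rel))) modpi_eq subr0.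
exact: spanmS.
Qed.

Lemma tens_balanced : balanced tens.
Proof.
split=> [m m' x|m x x'|m a x]; apply/eqP.
- rewrite -subr_eq0 opprD addrA /tens -!linearB; apply/eqP/tens_rel0.
  by left; left; exists m, m', x.
- rewrite -subr_eq0 opprD addrA /tens -!linearB; apply/eqP/tens_rel0.
  by left; right; exists m, x, x'.
- rewrite -subr_eq0 /tens -linearZ -linearB; apply/eqP/tens_rel0.
  by right; exists m, a, x.
Qed.

Section Lift.
Variables (W : lmodType F) (phi : M -> F -> W) (phiB : balanced phi).

Lemma tensor_lift0 t : t \in spanm tensor_rel ->
  fglift (fun p => phi p.1 p.2) t = 0.
Proof.
rewrite unfold_in => /asboolP tR; apply/eqP.
suff: t \in kerm (fglift (fun p => phi p.1 p.2)) by [].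
apply: tR => {}t tR; rewrite unfold_in; apply/eqP.
case: phiB => phiDl phiDr phiZ.
case: tR => [[[m [m' [x ->]]]|[m [x [x' ->]]]]|[m [a [x ->]]]].
- by rewrite !linearB /= !liftU !scale1r phiDl -addrA -opprD subrr.
- by rewrite !linearB /= !liftU !scale1r phiDr -addrA -opprD subrr.
- by rewrite linearB linearZ /= !liftU !scale1r phiZ subrr.
Qed.

Definition tensor_lift : {linear tensor -> W} :=
  modlift tensor_lift0.

Lemma tensor_liftE m x : tensor_lift (tens m x) = phi m x.
Proof. by rewrite [LHS](modliftE tensor_lift0) /= liftU scale1r. Qed.
End Lift.

Definition extend_scalars (m : M) : tensor := tens m 1.
End Tensor.

Section TensorMap.
Variables (M N : lmodType int) (F : nzRingType) (f : {linear M -> N}).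

Lemma tensor_map_balanced : balanced (fun m (x : F) => tens (f m) x).
Proof.
have [tDl tDr tZ] := tens_balanced N F.
by split=> *; rewrite ?linearD ?tDl ?tDr ?tZ.
Qed.

Definition tensor_map : {linear tensor M F -> tensor N F} :=
  tensor_lift tensor_map_balanced.
End TensorMap.

Section UniversalCoefficients.
Variables (R : realType) (F : nzRingType) (X : topologicalType).
Local Notation CZ := (singular R int X).
Local Notation CF := (singular R F X).

(* zmodule M is the abelian group M with its canonical int-module structure. *)
Definition coef_chain k : {linear CZ k -> zmodule (CF k)} :=
  fglift (fun s => << s >> : zmodule (CF k)).

Lemma coef_chainU k (s : sing R X k) : coef_chain k << s >> = << s >>.
Proof. by rewrite /coef_chain /= liftU scale1r. Qed.

Definition zbd k (x : zmodule (CF k.+1)) : zmodule (CF k) := bd CF x.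
Lemma zbd_linear k : linear (@zbd k).
Proof. by move=> a x y; rewrite /zbd !scalezrE linearD raddfMz. Qed.
HB.instance Definition _ k := GRing.isLinear.Build int
  (zmodule (CF k.+1)) (zmodule (CF k)) _ (@zbd k) (@zbd_linear k).

Lemma coef_chain_bd k x : bd CF (coef_chain k.+1 x) = coef_chain k (bd CZ x).
Proof.
apply: (eq_freeg (f := @zbd k \o coef_chain k.+1)
  (g := coef_chain k \o bd CZ (n := k))) => s /=.
rewrite coef_chainU /zbd [LHS]sing_bdU.
rewrite [X in coef_chain _ X]sing_bdU.
rewrite raddf_sum; apply: eq_bigr => i _.
rewrite -(signr_odd F) -(signr_odd int); case: (odd i).
  rewrite !expr1 [LHS]scaleN1r (_ : -1 *: << sing_face s i >> = - << sing_face s i >>).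
    by rewrite raddfN; congr (- _); rewrite [RHS]coef_chainU.
  exact: scaleN1r.
by rewrite !expr0 [LHS]scale1r (_ : 1 *: << _ >> = << sing_face s i >>) ?scale1r //
  [RHS]coef_chainU.
Qed.

Lemma coef_cycle_subproof n (z : cycles CZ n) :
  @cycle_pred F CF n (coef_chain n (val z)).
Proof.
case: n z => [//|n] [z dz]; have dz0 : bd CZ z = 0 by exact/eqP.
by apply/eqP; rewrite coef_chain_bd dz0 linear0.
Qed.

Definition coef_cycle n (z : cycles CZ n) : cycles CF n :=
  Submodule (coef_cycle_subproof z).

Definition coef_class n (z : cycles CZ n) : zmodule (homology CF n) :=
  hclass CF n (coef_cycle z).
Lemma coef_class_linear n : linear (@coef_class n).
Proof.
move=> a x y; rewrite /coef_class scalezrE -raddfMz -raddfD.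
congr (hclass _ _ _); apply/val_inj; rewrite /= linearP; congr (_ + _).
exact/esym/(raddfMz (val : cycles CF n -> CF n)).
Qed.
HB.instance Definition _ n := GRing.isLinear.Build int (cycles CZ n)
  (zmodule (homology CF n)) _ (@coef_class n) (@coef_class_linear n).

Lemma coef_class_boundary n z : z \in boundaries CZ n -> @coef_class n z = 0.
Proof.
rewrite unfold_in => /asboolP[c cz]; apply/eqP.
rewrite -[0](linear0 (hclass CF n)) modpi_eq subr0.
by rewrite unfold_in; apply/asboolP; exists (coef_chain n.+1 c); rewrite coef_chain_bd cz.
Qed.

Definition coef_homology n : {linear homology CZ n -> zmodule (homology CF n)} :=
  modlift (@coef_class_boundary n).

Lemma coef_homologyE n z :
  coef_homology n (hclass CZ n z) = hclass CF n (coef_cycle z).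
Proof. exact: modliftE. Qed.

Lemma uct_balanced n :
  balanced (fun h (x : F) => x *: (coef_homology n h : homology CF n)).
Proof.
split=> [h h' x|h x x'|h a x]; last by rewrite scalerA.
  by rewrite linearD /= scalerDr.
by rewrite scalerDl.
Qed.

(* The natural map of the universal coefficient theorem, [z] (x) x |-> x [z]. *)
Definition uct n : {linear tensor (sing_homology R int X n) F -> sing_homology R F X n} :=
  tensor_lift (uct_balanced n).

End UniversalCoefficients.

Section Persistence.
Variables (d : Order.disp_t) (I : orderType d).

(* The structure maps are topological embeddings (injective, with the induced
   topology), that is, inclusions of subspaces up to renaming of points. *)
Record filtration := Filtration {
  space :> I -> topologicalType;
  incl_map : forall a b, (a <= b)%O -> continuousType (space a) (space b);
  incl_inj : forall a b (ab : (a <= b)%O), injective (incl_map ab);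
  incl_open : forall a b (ab : (a <= b)%O) (U : set (space a)),
    open U -> exists2 V, open V & incl_map ab @^-1` V = U;
  incl_id : forall a (aa : (a <= a)%O) x, incl_map aa x = x;
  incl_comp : forall a b c (ab : (a <= b)%O) (bc : (b <= c)%O) (ac : (a <= c)%O) x,
    incl_map ac x = incl_map bc (incl_map ab x)
}.

Record pmodule (A : nzRingType) := PModule {
  pobj :> I -> lmodType A;
  pmap : forall a b, (a <= b)%O -> {linear pobj a -> pobj b};
  pmap_id : forall a (aa : (a <= a)%O) x, pmap aa x = x;
  pmap_comp : forall a b c (ab : (a <= b)%O) (bc : (b <= c)%O) (ac : (a <= c)%O) x,
    pmap ac x = pmap bc (pmap ab x)
}.
Arguments pmap {A} M {a b} : rename.

Section FiltrationHomology.
Variables (R : realType) (K : filtration) (n : nat) (A : nzRingType).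

Lemma filtration_homology_id a (aa : (a <= a)%O) h :
  sing_homology_map R A (incl_map K aa) n h = h.
Proof.
apply: homology_map_id => {h}m x.
apply: (eq_freeg (g := idfun)) => s; rewrite [LHS]sing_mapU.
by congr << _ >>; apply/continuousEP => y /=; rewrite incl_id.
Qed.

Lemma filtration_homology_comp a b c (ab : (a <= b)%O) (bc : (b <= c)%O)
    (ac : (a <= c)%O) h :
  sing_homology_map R A (incl_map K ac) n h =
  sing_homology_map R A (incl_map K bc) n
    (sing_homology_map R A (incl_map K ab) n h).
Proof.
apply: (homology_map_comp (f := singular_map R A (incl_map K ab))
  (g := singular_map R A (incl_map K bc))) => {h}m x.
apply: (eq_freeg (g := singular_map R A (incl_map K bc) m \o singular_map R A (incl_map K ab) m)).
move=> s; rewrite [LHS]sing_mapU /= [X in fglift _ X]sing_mapU [RHS]sing_mapU.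
by congr << _ >>; apply/continuousEP => y /=; rewrite -incl_comp.
Qed.

Definition filtration_homology : pmodule A :=
  PModule filtration_homology_id filtration_homology_comp.
End FiltrationHomology.

Section PModuleTheory.
Variable A : nzRingType.
Implicit Type M : pmodule A.

Definition pisomorphic (M N : pmodule A) := exists phi : forall a, {linear M a -> N a},
  (forall a, bijective (phi a)) /\
  forall a b (ab : (a <= b)%O) x, phi b (pmap M ab x) = pmap N ab (phi a x).

Record psubmodule M := PSubmodule {
  psub_at :> forall a, submodClosed (M a);
  psub_pmap : forall a b (ab : (a <= b)%O) x,
    x \in psub_at a -> pmap M ab x \in psub_at b
}.

Section SubAsModule.
Variables (M : pmodule A) (N : psubmodule M).

Definition psub_map a b (ab : (a <= b)%O) (x : submodule (N a)) : submodule (N b) :=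
  Submodule (psub_pmap ab (valP x)).
Lemma psub_map_linear a b (ab : (a <= b)%O) : linear (psub_map ab).
Proof. by move=> k x y; apply/val_inj; rewrite /= !linearP. Qed.
HB.instance Definition _ a b (ab : (a <= b)%O) := GRing.isLinear.Build A
  (submodule (N a)) (submodule (N b)) _ (psub_map ab) (psub_map_linear ab).

Lemma psub_map_id a (aa : (a <= a)%O) x : psub_map aa x = x.
Proof. by apply/val_inj; rewrite /= pmap_id. Qed.
Lemma psub_map_comp a b c (ab : (a <= b)%O) (bc : (b <= c)%O) (ac : (a <= c)%O) x :
  psub_map ac x = psub_map bc (psub_map ab x).
Proof. by apply/val_inj; rewrite /= -pmap_comp. Qed.

Definition psub : pmodule A :=
  @PModule A (fun a => submodule (N a)) (fun a b ab => psub_map ab)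
    psub_map_id psub_map_comp.
End SubAsModule.

Definition interval_set (J : set I) :=
  forall a b c, J a -> J b -> (a <= c)%O -> (c <= b)%O -> J c.

Section IntervalModule.
Variables (J : set I) (Jitv : interval_set J).

Definition itv_obj_of (x : bool) : lmodType A := if x then (A^o : lmodType A) else ('rV[A]_0 : lmodType A).
Definition itv_map_of (x y : bool) : {linear itv_obj_of x -> itv_obj_of y} :=
  match x, y return {linear itv_obj_of x -> itv_obj_of y} with
  | true, true => idfun
  | _, _ => \0
  end.

Definition itv_obj (a : I) := itv_obj_of `[< J a >].
Definition itv_map a b of (a <= b)%O : {linear itv_obj a -> itv_obj b} :=
  itv_map_of `[< J a >] `[< J b >].

Lemma itv_map_id a (aa : (a <= a)%O) x : itv_map aa x = x.
Proof.
rewrite /itv_map; move: x; rewrite /itv_obj; case: `[< J a >] => //= x.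
by apply/rowP; case.
Qed.
Lemma itv_map_comp a b c (ab : (a <= b)%O) (bc : (b <= c)%O) (ac : (a <= c)%O) x :
  itv_map ac x = itv_map bc (itv_map ab x).
Proof.
have : `[< J a >] -> `[< J c >] -> `[< J b >].
  by move=> /asboolP Ja /asboolP Jc; apply/asboolP/(Jitv Ja Jc).
rewrite /itv_map; move: x; rewrite /itv_obj.
case: `[< J a >]; case: `[< J b >]; case: `[< J c >] => //= x; first by move/(_ isT isT).
Qed.

Definition itv_module : pmodule A := PModule itv_map_id itv_map_comp.
End IntervalModule.

Definition interval_submodule M (N : psubmodule M) (J : set I) :=
  exists Jitv : interval_set J, pisomorphic (psub N) (itv_module Jitv).

Definition direct_sum_of M (L : choiceType) (N : L -> psubmodule M) :=
  forall a,
    (forall x : M a, exists (s : seq L) (y : L -> M a),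
       (forall l, y l \in N l a) /\ x = \sum_(l <- s) y l) /\
    (forall (s : seq L) (y : L -> M a), uniq s -> (forall l, y l \in N l a) ->
       \sum_(l <- s) y l = 0 -> forall l, l \in s -> y l = 0).

Definition interval_decomposition M (L : choiceType) (N : L -> psubmodule M)
    (J : L -> set I) :=
  direct_sum_of N /\ forall l, interval_submodule (N l) (J l).

Definition interval_decomposable M := exists (L : choiceType)
  (N : L -> psubmodule M) (J : L -> set I), interval_decomposition N J.

(* D is the multiset of the nonempty intervals of some interval decomposition
   of M, given by its multiplicity function. *)
Definition decomposition_multiset M (D : set I -> nat) := exists (L : choiceType)
  (N : L -> psubmodule M) (J : L -> set I), interval_decomposition N J /\
  D set0 = 0%N /\ forall S, S !=set0 -> ([set l | J l = S] #= `I_(D S))%card.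

(* D is the persistence diagram of M: the unique multiset arising from an
   interval decomposition. *)
Definition persistence_diagram M (D : set I -> nat) :=
  forall D', decomposition_multiset M D' <-> D' = D.
End PModuleTheory.
End Persistence.

(* Main.v *)
(* A family of maps between finitely generated free abelian groups indexed
   by a total order, all of whose cokernels are free, consists of matrices X
   that are regular: X G X = X for some G, a condition stable under
   transposition. Fix t with X_tt nonzero and let P be the set of s <= t
   with X_st nonzero. By a Mittag-Leffler argument on stable images, in
   which ranks play the role of dimensions, there is r in P such that every
   element of the image of X_rt lifts compatibly over P. Dually, with Q the
   set of u >= t with X_ru nonzero, there is v in Q such that every
   functional factoring through X_tv extends compatibly over Q. Regularity
   of X_rv yields x and y with x X_rv y = 1: a generator and a retraction of
   a summand that is the interval module of the union of P and Q. By Zorn's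
   lemma there is a maximal family of orthogonal summands of this kind, and
   the complement, again a regular family, has to vanish. This gives (2) =>
   (1). Since H_n and H_(n-1) are torsion-free, H_n(K; F) is the extension
   of scalars of H_n(K; Z), so interval generators over Z are interval
   generators over F, and over a field the number of intervals containing a
   and b is the rank of the map from a to b; counting determines the
   multiset, whence (1) => (4). Conversely, equality of the ranks over Q and
   over F_p excludes p-torsion from the cokernels. Finally H_n(K_b, K_a) is
   an extension of a subgroup of the free group H_(n-1)(K_a) by the
   cokernel, so (2) <=> (3). *)
From HB Require Import structures.
Require Import Defs.
From mathcomp.multinomials Require Import freeg.
From mathcomp Require Import all_boot all_order all_algebra.
From mathcomp Require Import all_classical all_reals topology normedtype.
Import Order.TTheory GRing.Theory Num.Theory.
Local Open Scope classical_set_scope.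
Local Open Scope ring_scope.

Set Implicit Arguments.
Unset Strict Implicit.

(** * Integer matrices *)

(** The Smith form of a single row has at most one nonzero entry, so only the first row of the right
    unimodular factor contributes. *)
Lemma row_int_factor m (c : 'rV[int]_m.+1) :
  exists (k : int) (U : 'M[int]_m.+1), U \in unitmx /\ c = k *: row 0 U.
Proof.
have [L _ [U Uu [d _ cE]]] := int_Smith_normal_form c.
exists (L 0 0 * d`_0), U; split=> //; apply/rowP => j.
rewrite cE mxE big_ord_recl big1 ?addr0 => [|i _]; rewrite !mxE.
  by rewrite big_ord1 !mxE mulr1n.
by rewrite big_ord1 !mxE mulr0n mulr0 mul0r.
Qed.

Section GeneratorReduction.
(** [T] collects the coefficients regarded as trivial: only 0 when [V] is torsion-free, and the
    kernel of the map from the integers to [F] when [V] is the additive group of a field [F]. *)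
Variables (V : lmodType int) (T : int -> Prop).
Hypothesis TM : forall a b, T a -> T (a * b).
Hypothesis VT : forall a (v : V), a *: v = 0 -> T a \/ v = 0.

(* A relation [c] among the generators is a multiple of the first row of a
   unimodular matrix, and changing basis by that matrix kills a generator. *)
Lemma reduce_generators m (g : {linear 'rV[int]_m -> V}) :
  exists m' (g' : {linear 'rV[int]_m' -> V}) (A : 'M[int]_(m, m')) (B : 'M[int]_(m', m)),
    [/\ forall x, g x = g' (x *m A), forall y, g' y = g (y *m B)
      & forall c, g' c = 0 -> forall j, T (c 0 j)].
Proof.
elim: m g => [|m IHm] g.
  by exists 0, g, 1%:M, 1%:M; split=> [x|y|c _ []//]; rewrite mulmx1.
have [indep|] := pselect (forall c, g c = 0 -> forall j, T (c 0 j)).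
  by exists m.+1, g, 1%:M, 1%:M; split=> [x|y|//]; rewrite mulmx1.
move=> /existsNP[c /not_implyP[gc /existsNP[j cj]]].
have [k [U [Uu cE]]] := row_int_factor c.
have {j cj}gU0 : g (row 0 U) = 0.
  move: gc; rewrite cE linearZ => /VT[Tk|//].
  by case: cj; rewrite cE !mxE; apply: TM.
(* The rows of [U] form a basis whose first vector is killed by [g]. [B1] lists the other rows, and
   [A1] reads off the coordinates along them. *)
pose B1 : 'M[int]_(m, 1 + m) := row_mx 0 1%:M *m (U : 'M_(1 + m)).
pose A1 : 'M[int]_(1 + m, m) := rsubmx (invmx U : 'M_(1 + m)).
pose g1 : {linear 'rV[int]_m -> V} := g \o mulmxr B1.
have gA1 x : g x = g1 (x *m A1).
  set y : 'rV_(1 + m) := x *m invmx U.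
  have -> : x *m A1 = rsubmx y by rewrite /A1 /y -mulmx_rsub.
  rewrite -[in LHS](mulmxKV Uu x) -/y -[in LHS](hsubmxK y).
  have -> : row_mx (lsubmx y) (rsubmx y) = lsubmx y *m row_mx 1%:M 0 + rsubmx y *m row_mx 0 1%:M.
    by rewrite !mul_mx_row !mulmx1 !mulmx0 add_row_mx addr0 add0r.
  rewrite mulmxDl linearD /= -!mulmxA -/B1 [X in X + _](_ : _ = 0) ?add0r //.
  rewrite [lsubmx y]mx11_scalar mul_scalar_mx linearZ /=.
  rewrite (_ : row_mx 1%:M 0 *m _ = row 0 U) ?gU0 ?scaler0 //.
  by rewrite rowE; congr (_ *m _); apply/rowP => j; rewrite !mxE; case: splitP => i ij; rewrite !mxE eqxx -(val_eqE j) /= ij ?ord1.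
have [m' [g' [A [B [gA gB ind]]]]] := IHm g1.
exists m', g', (A1 *m A), (B *m B1); split=> // [x|y].
  by rewrite gA1 gA mulmxA.
by rewrite gB mulmxA.
Qed.
End GeneratorReduction.

(** Zorn's lemma for pairwise related sets containing [C]. The diagonal condition [Q z z] doubles as
    an admissibility condition on single elements. *)
Lemma maximal_pairwise (T : Type) (Q : T -> T -> Prop) (C : set T) :
  (forall x y, C x -> C y -> Q x y) ->
  exists A : set T, [/\ C `<=` A, forall x y, A x -> A y -> Q x y
    & forall z, Q z z -> (forall x, A x -> Q x z /\ Q z x) -> A z].
Proof.
move=> QC.
(* Adjoining [C] inside the predicate makes the union of the empty chain admissible and keeps [C] in
   the maximal set. *)
pose P (A : set T) := forall x y, (C `|` A) x -> (C `|` A) y -> Q x y.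
have [F FP Ftot|A [PA Amax]] := @Zorn_bigcup T P.
  move=> x y [Cx|[A FA Ax]] [Cy|[B FB By]]; first exact: QC.
  - by apply: (FP _ FB); [left | right].
  - by apply: (FP _ FA); [right | left].
  - by have [AB|BA] := Ftot _ _ FA FB;
      [apply: (FP _ FB); right=> //; exact: AB | apply: (FP _ FA); right=> //; exact: BA].
exists (C `|` A); split=> // z Qz zA; right.
apply: contrapT => nAz; apply: (Amax (A `|` [set z])).
  by split=> [x Ax|/(_ z)]; [left | move=> zA'; apply: nAz; apply: zA'; right].
have zCA x : (C `|` (A `|` [set z])) x -> (C `|` A) x \/ x = z.
  by case=> [Cx|[Ax|->]]; [left; left | left; right | right].
move=> x y /zCA[CAx|->] /zCA[CAy|->] //; first exact: PA.
  exact: (zA _ CAx).1.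
exact: (zA _ CAy).2.
Qed.

(** Regularity in the sense of von Neumann: the integral form of a free cokernel, stated so that
    transposition visibly preserves it. *)
Definition regular m n (X : 'M[int]_(m, n)) :=
  exists G : 'M[int]_(n, m), X *m G *m X = X.

Definition ratmx m n (X : 'M[int]_(m, n)) : 'M[rat]_(m, n) := map_mx intr X.

Lemma ratmx_inj m n : injective (@ratmx m n).
Proof.
move=> X Y /matrixP XY; apply/matrixP => i j; move: (XY i j); rewrite !mxE.
exact: intr_inj.
Qed.

Lemma ratmxM m n p (X : 'M[int]_(m, n)) (Y : 'M_(n, p)) :
  ratmx (X *m Y) = ratmx X *m ratmx Y.
Proof. exact: map_mxM. Qed.

Lemma ratmx0 m n : ratmx (0 : 'M_(m, n)) = 0.
Proof. exact: map_mx0. Qed.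

Lemma regular_tr m n (X : 'M[int]_(m, n)) : regular X -> regular X^T.
Proof. by case=> G XG; exists G^T; rewrite -!trmx_mul mulmxA XG. Qed.

(** Equal rational ranks make the row spaces coincide, so [Y = U X] over the rationals. Then
    [Y G X = U X G X = Y], and [Y G] is an integral factor. *)
Lemma regular_factor m m' n (X : 'M[int]_(m, n)) (Y : 'M_(m', n)) W :
  regular X -> X = W *m Y -> (\rank (ratmx Y) <= \rank (ratmx X))%N ->
  exists Z, Y = Z *m X.
Proof.
move=> [G XG] XE rYX.
have sXY : (ratmx X <= ratmx Y)%MS by rewrite XE ratmxM submxMl.
have : (ratmx Y <= ratmx X)%MS by rewrite -(geq_leqif (mxrank_leqif_sup sXY)).
move=> /submxP[U YE]; exists (Y *m G); apply: ratmx_inj.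
by rewrite !ratmxM YE -!mulmxA [_ *m (ratmx G *m _)]mulmxA -!ratmxM XG.
Qed.

(** In Smith form the regularity equation forces the first invariant factor to be a unit; the
    pairing isolates that entry. *)
Lemma regular_pairing m n (X : 'M[int]_(m, n)) : regular X -> X != 0 ->
  exists (x : 'rV_m) (y : 'cV_n), x *m X *m y = 1%:M.
Proof.
move=> [G XG] X0.
have [L Lu [R Ru [d ds XE]]] := int_Smith_normal_form X.
set D := (\matrix_(i, j) _) in XE.
have D0 : D != 0 by apply: contra_neq X0 => D0; rewrite XE D0 mulmx0 mul0mx.
(* The first invariant factor divides all the others, so if it vanished the whole matrix would. *)
have d0 : d`_0 != 0.
  apply: contra_neq D0 => d0; apply/matrixP => i j; rewrite !mxE.
  suff -> : d`_i = 0 by rewrite mul0rn.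
  case: (d) ds d0 => [|a s /= sa a0]; first by move=> _ _; rewrite nth_nil.
  rewrite {}a0 in sa *; case: (nat_of_ord i) => // k /=.
  have [ks|] := ltnP k (size s); last by move=> ?; rewrite nth_default.
  have /allP/(_ _ (mem_nth 0 ks)) := order_path_min dvdz_trans sa.
  by rewrite dvd0z => /eqP.
have DE i j : D i j = d`_i *+ (i == j :> nat) by rewrite mxE.
case: m n X G R Ru L Lu D D0 DE XE XG X0 => [|m] [|n] X G R Ru L Lu D D0 DE XE XG X0;
  [by rewrite (flatmx0 X) eqxx in X0|by rewrite (flatmx0 X) eqxx in X0|
   by rewrite (thinmx0 X) eqxx in X0|].
pose G' := R *m G *m L.
have DGD : D *m G' *m D = D.
  move: XG; rewrite XE => /(congr1 (fun Y => invmx L *m Y *m invmx R)).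
  by rewrite !mulmxA !(mulVmx Lu, mul1mx) !(mulmxK Ru) -!mulmxA.
have rowD : row 0 D = d`_0 *: delta_mx 0 0.
  by apply/rowP => j; rewrite !mxE DE eqxx /= mulr_natr -(val_eqE j) eq_sym.
have colD : col 0 D = d`_0 *: delta_mx 0 0.
  apply/colP => j; rewrite !mxE DE eqxx andbT mulr_natr -(val_eqE j) /=.
  by case: eqP => [->|_] //; rewrite !mulr0n.
have D00 : D 0 0 = d`_0 by rewrite DE mulr1n.
(* The corner entry of [D G' D = D] reads [d_0 G'_00 d_0 = d_0], and [d_0] can be cancelled. *)
have u1 : G' 0 0 * d`_0 = 1.
  apply: (mulfI d0); rewrite mulr1 -[in RHS]D00 -DGD.
  have -> : (D *m G' *m D) 0 0 = (row 0 (D *m G' *m D) *m (delta_mx 0 0 : 'cV_n.+1)) 0 0.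
    by rewrite -colE [RHS]mxE [RHS]mxE.
  rewrite !row_mul -[_ *m D *m _]mulmxA -colE rowD colD.
  by rewrite -!scalemxAl -!scalemxAr -rowE -colE !mxE [X in _ * X]mulrC.
exists (delta_mx 0 0 *m invmx L), (invmx R *m (G' 0 0 *: delta_mx 0 0)).
rewrite XE -!mulmxA mulKmx // mulKVmx // -[D *m _]scalemxAr -colE colD.
rewrite scalerA u1 scale1r -rowE; apply/matrixP => i j.
by rewrite !mxE !ord1.
Qed.

Lemma exists_minimizer (T : Type) (P : T -> Prop) (f : T -> nat) x0 : P x0 ->
  exists x, P x /\ forall y, P y -> (f x <= f y)%N.
Proof.
move=> Px0; pose Q n := `[< exists x, P x /\ f x = n >].
have exQ : exists n, Q n by exists (f x0); apply/asboolP; exists x0.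
case: (ex_minnP exQ) => n /asboolP[x [Px <-]] nmin; exists x; split=> // y Py.
by apply: nmin; apply/asboolP; exists y.
Qed.

Lemma exists_maximizer (T : Type) (P : T -> Prop) (f : T -> nat) m x0 :
  (forall y, P y -> f y <= m)%N -> P x0 ->
  exists x, P x /\ forall y, P y -> (f y <= f x)%N.
Proof.
move=> fm Px0; have [x [Px xmin]] := exists_minimizer (fun x => m - f x)%N Px0.
exists x; split=> // y Py; have := xmin _ Py.
by rewrite leq_sub2lE // fm.
Qed.

(** * Stable images and compatible lifts in regular systems *)

Section RegularSystem.
Variables (d : Order.disp_t) (I : orderType d) (r : I -> nat).

(* The identities are not required to act as identities: [X a a] is only
   idempotent, so that a direct summand of a system on the same ranks is again
   a system. *)
Definition regular_system (X : forall a b, 'M[int]_(r a, r b)) :=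
  (forall a b c, (a <= b)%O -> (b <= c)%O -> X a b *m X b c = X a c) /\
  (forall a b, (a <= b)%O -> regular (X a b)).

Section Lifting.
Variable X : forall a b, 'M[int]_(r a, r b).
Hypothesis Xsys : regular_system X.
Let XM := Xsys.1.
Let Xreg := Xsys.2.

Definition sysrank a b := \rank (ratmx (X a b)).

Lemma sysrankMl a b c : (a <= b)%O -> (b <= c)%O -> (sysrank a c <= sysrank a b)%N.
Proof. by move=> ab bc; rewrite /sysrank -(XM ab bc) ratmxM mxrankM_maxl. Qed.

Variables (P : set I) (t : I).
Hypothesis Pt : P t.

(** Ranks are natural numbers, so the images in [s] of the earlier members of [P] attain a minimal
    rank. The premise [P s] stays under the existential so that [choice] gives a function on all of
    [I]. *)
Lemma stable_index s : exists u, P s ->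
  [/\ P u, (u <= s)%O & forall u', P u' -> (u' <= s)%O -> (sysrank u s <= sysrank u' s)%N].
Proof.
have [Ps|nPs] := pselect (P s); last by exists s.
have Q0 : P s /\ (s <= s)%O by [].
have [u [[Pu us] umin]] :=
  @exists_minimizer I (fun u => P u /\ (u <= s)%O) (sysrank^~ s) s Q0.
by exists u => _; split=> // u' Pu' u's; apply: umin.
Qed.

(** Mittag-Leffler argument: the stable images [S s] map onto one another, and their ranks do not
    increase along the order. Zorn's lemma gives a maximal compatible partial family in the [S s]
    through the given element at [t], and such a family is defined on all of [P]. *)
Lemma lift_family : exists u, P u /\ (u <= t)%O /\ forall y : 'rV_(r u),
  exists e : forall s, 'rV[int]_(r s), e t = y *m X u t /\
    forall s s', P s -> P s' -> (s <= s')%O -> e s *m X s s' = e s'.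
Proof.
have [rho rhoP] := choice stable_index.
have Prho s : P s -> P (rho s) by case/rhoP.
have rho_le s : P s -> (rho s <= s)%O by case/rhoP.
have rho_min s u : P s -> P u -> (u <= s)%O -> (sysrank (rho s) s <= sysrank u s)%N.
  by move=> /rhoP[_ _ h]; apply: h.
(* The stable image at [s] lies in the image of every [X u s]. If [u] is above [rho s] this is
   functoriality; below, the rational ranks agree and regularity makes the factorization
   integral. *)
have stab u s : P s -> P u -> (u <= s)%O -> exists Y, X (rho s) s = Y *m X u s.
  move=> Ps Pu us; have [le_rs|lt_sr] := leP u (rho s).
    apply: (regular_factor (Xreg us) (esym (XM le_rs (rho_le _ Ps)))).
    exact: rho_min.
  by exists (X (rho s) u); rewrite XM // ltW.
pose S s (x : 'rV_(r s)) := exists y, x = y *m X (rho s) s.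
have S_lift u s (x : 'rV_(r s)) : P u -> P s -> (u <= s)%O -> S s x ->
    exists2 x', S u x' & x' *m X u s = x.
  move=> Pu Ps us [y ->].
  have [Y ->] := stab _ _ Ps (Prho _ Pu) (le_trans (rho_le _ Pu) us).
  exists (y *m Y *m X (rho u) u); first by exists (y *m Y).
  by rewrite -!mulmxA XM // rho_le.
have S_push u s (x : 'rV_(r u)) : P u -> P s -> (u <= s)%O -> S u x -> S s (x *m X u s).
  move=> Pu Ps us [y ->].
  have [le_rr|lt_rr] := leP (rho u) (rho s).
    exists (y *m X (rho u) (rho s)).
    by rewrite -!mulmxA !XM // ?rho_le.
  have [Y ->] := stab _ _ Pu (Prho _ Ps) (le_trans (ltW lt_rr) (rho_le _ Pu)).
  exists (y *m Y).
  by rewrite -!mulmxA !XM // ?(le_trans (ltW lt_rr) (rho_le _ Pu)).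
have S_id s (x : 'rV_(r s)) : P s -> S s x -> x *m X s s = x.
  by move=> Ps [y ->]; rewrite -mulmxA XM // rho_le.
pose rk s := sysrank (rho s) s.
(* Rank-nullity on the stable image: by minimality at [s] the composite [X (rho u) s] has rank at
   least [rk s], hence at least [rk u], which leaves no room for a kernel. *)
have S_inj u s (x : 'rV_(r u)) : P u -> P s -> (u <= s)%O -> (rk u <= rk s)%N ->
    S u x -> x *m X u s = 0 -> x = 0.
  move=> Pu Ps us rk_us [y ->]; rewrite -mulmxA XM ?rho_le // => y0.
  apply: ratmx_inj; rewrite ratmx0; apply/eqP; rewrite -submx0.
  have /eqP <- : (ratmx (X (rho u) u) :&: kermx (ratmx (X u s)))%MS == 0.
    rewrite -mxrank_eq0 -(eqn_add2l (rk u)) addn0 eqn_leq {2}/rk /sysrank.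
    rewrite -[X in (_ <= X)%N && _](mxrank_mul_ker _ (ratmx (X u s))).
    rewrite leq_add2r -ratmxM XM ?rho_le // leq_addr andbT.
    apply: leq_trans rk_us _; apply: rho_min => //; first exact: Prho.
    exact: le_trans (rho_le _ Pu) us.
  rewrite sub_capmx ratmxM submxMl; apply/sub_kermxP.
  by rewrite -!ratmxM -mulmxA XM ?rho_le // y0 ratmx0.
exists (rho t); split; first exact: Prho.
split; first exact: rho_le.
move=> y; set xt := y *m X (rho t) t.
have Sxt : S t xt by exists y.
(* A partial family is encoded as a set of pairs of an index and a value. On the diagonal, [Q] says
   that the index is in [P], the value is stable, and [X s s] fixes it. *)
pose pt := {s : I & 'rV[int]_(r s)}; pose pk s (x : 'rV_(r s)) : pt := existT _ s x; pose P0 := pk _ xt.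
pose Q (p q : pt) := [/\ P (tag p), S (tag p) (tagged p) &
  (tag p <= tag q)%O -> tagged p *m X (tag p) (tag q) = tagged q].
have [|G [GP0 GQ Gmax]] := @maximal_pairwise pt Q [set P0].
  by move=> _ _ -> ->; split=> // _; apply: S_id.
have Gt : G P0 by exact: GP0.
have domG s : P s -> exists x, G (pk s x).
  move=> Ps; apply: contrapT => /forallNP nGs.
  (* A stable value at [s] compatible with all of [G] belongs to [G] by maximality, against the
     assumption that [G] has no value at [s]. *)
  have extend x : S s x ->
      (forall u y, G (pk u y) -> (u <= s)%O -> y *m X u s = x) ->
      (forall u y, G (pk u y) -> (s <= u)%O -> x *m X s u = y) -> False.
    move=> Sx Gl Gr; apply: (nGs x); apply: Gmax.
      by split=> // _; apply: S_id.
    move=> [u z] Gz; have [Pu Su _] := GQ _ _ Gz Gz.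
    by split; split=> // su; [apply: Gl | apply: Gr].
  (* If the family is already defined at some index at or below [s], its value there is pushed
     forward. *)
  have [[[s0 x0] [/= s0s G0]]|] := pselect (exists p : pt, (tag p <= s)%O /\ G p).
    have [/= Ps0 Ss0 _] := GQ _ _ G0 G0.
    apply: (extend (x0 *m X s0 s)); first exact: S_push.
      move=> u z Gz us; have [/= Pu _ Gu0] := GQ _ _ Gz G0.
      have [/= _ _ G0u] := GQ _ _ G0 Gz.
      have [us0|s0u] := leP u s0; first by rewrite -Gu0 // -mulmxA XM.
      by rewrite -G0u ?ltW // -mulmxA XM // ltW.
    move=> u z Gz su; rewrite -mulmxA XM //.
    by have [/= _ _ ->//] := GQ _ _ G0 Gz; apply: le_trans su.
  move=> /forallNP Gs.
  have sG u (z : 'rV_(r u)) : G (pk u z) -> (s < u)%O.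
    by move=> Gz; rewrite ltNge; apply/negP => us; apply: (Gs (pk _ z)).
  have rk_mono u v : P u -> P v -> (u <= v)%O -> (rk v <= rk u)%N.
    move=> Pu Pv uv; apply: leq_trans (sysrankMl (rho_le _ Pu) uv).
    by apply: rho_min (Prho _ Pu) _ => //; apply: le_trans uv; apply: rho_le.
  (* Otherwise the whole domain lies above [s], which bounds the ranks by [rk s]. The value is
     lifted from an index [u0] of maximal rank. *)
  have [||[u0 z0] [Gz0 z0max]] :=
      @exists_maximizer pt (fun p => G p) (fun p => rk (tag p)) (rk s) P0 => //.
    move=> [u z] Gz; have [/= Pu _ _] := GQ _ _ Gz Gz.
    by apply: rk_mono => //; apply/ltW/(sG _ _ Gz).
  have [/= Pu0 Su0 _] := GQ _ _ Gz0 Gz0.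
  have su0 := sG _ _ Gz0.
  have [x Sx xz0] := S_lift _ _ _ Ps Pu0 (ltW su0) Su0.
  apply: (extend x Sx) => u z Gz; first by rewrite leNgt (sG _ _ Gz).
  move=> su; have [/= Pu Su Gu0] := GQ _ _ Gz Gz0.
  have [u0u|uu0] := leP u0 u.
    by have [/= _ _ <-//] := GQ _ _ Gz0 Gz; rewrite -xz0 -mulmxA XM // ltW.
  (* Below [u0] the rank cannot exceed that at [u0], so [X u u0] is injective on the stable image;
     the two candidates agree because they have the same value at [u0]. *)
  apply/eqP; rewrite -subr_eq0; apply/eqP.
  apply: (S_inj u u0) => //; first exact: ltW.
  - exact: (z0max _ Gz).
  - have [y1 y1E] := S_push _ _ _ Ps Pu su Sx; have [y2 y2E] := Su.
    by exists (y1 - y2); rewrite mulmxBl -y1E -y2E.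
  - by rewrite mulmxBl -mulmxA XM ?(ltW uu0) // xz0 Gu0 ?subrr // ltW.
have ex_e s : exists x, P s -> G (pk s x).
  have [/domG[x Gx]|nPs] := pselect (P s); first by exists x.
  by exists 0.
pose e s := sval (cid (ex_e s)).
have eP s : P s -> G (pk s (e s)) by exact: svalP (cid (ex_e s)).
exists e; split.
  have := eP _ Pt => Ge; have [/= _ Se _] := GQ _ _ Ge Ge.
  have [/= _ _ /(_ (lexx _)) <-] := GQ _ _ Ge Gt.
  by rewrite S_id.
by move=> s s' /eP Gs /eP Gs' ss'; have [/= _ _ ->] := GQ _ _ Gs Gs'.
Qed.
End Lifting.
End RegularSystem.

(** * Interval summands *)

Section IntervalPairs.
Variables (d : Order.disp_t) (I : orderType d) (r : I -> nat).
Implicit Type X : forall a b, 'M[int]_(r a, r b).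

(** Transposing the matrices and reversing the order turns functionals into elements, and the
    lifting result applies. *)
Lemma colift_family X (P : set I) (t : I) : regular_system X -> P t ->
  exists u, P u /\ (t <= u)%O /\ forall y : 'cV_(r u),
    exists p : forall s, 'cV[int]_(r s), p t = X t u *m y /\
      forall s s', P s -> P s' -> (s <= s')%O -> X s s' *m p s' = p s.
Proof.
move=> [XM Xreg] Pt.
pose X' (a b : I^d) : 'M[int]_(r a, r b) := (X b a)^T.
have X'sys : regular_system X'.
  split=> [a b c ab bc|a b ab]; last exact/regular_tr/Xreg.
  by rewrite -trmx_mul XM.
have [u [Pu [ut lift]]] := lift_family X'sys Pt.
exists u; split=> //; split=> // y.
have [e [et eP]] := lift y^T.
exists (fun s => (e s)^T); split; first by rewrite et -trmx_mul trmxK.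
move=> s s' Ps Ps' ss'.
by rewrite -(eP s' s) // trmx_mul trmxK.
Qed.

(* A direct summand isomorphic to the interval module of [J]: [e] is its
   generator and [p] the retraction onto it. *)
Definition interval_pair X (J : set I) (e : forall s, 'rV[int]_(r s))
    (p : forall s, 'cV[int]_(r s)) :=
  [/\ forall a b c, J a -> J b -> (a <= c)%O -> (c <= b)%O -> J c,
      forall s, ~ J s -> e s = 0 /\ p s = 0,
      forall s, J s -> e s *m p s = 1%:M,
      forall s s', (s <= s')%O -> J s -> e s *m X s s' = e s'
    & forall s s', (s <= s')%O -> J s' -> X s s' *m p s' = p s].

(** A generator is lifted compatibly below [t] and pushed forward above it; a functional is extended
    above [t] and pulled back below it. They are chosen to pair to 1 at [t], and compatibility
    carries this value along [J]. *)
Lemma exists_interval_pair X t : regular_system X -> X t t != 0 ->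
  exists J e p, J !=set0 /\ interval_pair X J e p.
Proof.
move=> Xsys Xt0; have [XM Xreg] := Xsys.
pose P : set I := fun s => (s <= t)%O /\ X s t != 0.
have X0l u v w : (u <= v)%O -> (v <= w)%O -> X u w != 0 -> X u v != 0.
  by move=> uv vw; apply: contra_neq => uv0; rewrite -(XM _ _ _ uv vw) uv0 mul0mx.
have X0r u v w : (u <= v)%O -> (v <= w)%O -> X u w != 0 -> X v w != 0.
  by move=> uv vw; apply: contra_neq => uv0; rewrite -(XM _ _ _ uv vw) uv0 mulmx0.
have P_up s s' : P s -> (s <= s')%O -> (s' <= t)%O -> P s'.
  by move=> [st Xst] ss' s't; split=> //; exact: X0r Xst.
have Pt : P t by [].
have [r1 [[r1t Xr1] [_ lift]]] := lift_family Xsys Pt.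
(* [Q] is cut out by [X r1 u] and not by [X t u]: the generator at [t] will come from [r1], so its
   image at [u] vanishes outside [Q]. *)
pose Q : set I := fun u => (t <= u)%O /\ X r1 u != 0.
have Q_down s s' : Q s' -> (s <= s')%O -> (t <= s)%O -> Q s.
  by move=> [ts' Xs'] ss' ts; split=> //; apply: X0l Xs' => //; apply: le_trans ts.
have [u0 [[tu0 Xu0] [_ colift]]] :=
  colift_family Xsys (conj (lexx t) Xr1 : Q t).
(* The last element [u0] from which functionals extend still has [X r1 u0] nonzero, so regularity
   provides vectors pairing to 1 through it. *)
have [x0 [y0 xy1]] := regular_pairing (Xreg _ _ (le_trans r1t tu0)) Xu0.
have [e [et eP]] := lift x0.
have [p [pt pP]] := colift y0.
have Qt : Q t by [].
have ett : e t *m X t t = e t by exact: eP.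
have ptt : X t t *m p t = p t by exact: pP.
have ept : e t *m p t = 1%:M by rewrite et pt -xy1 !mulmxA -(mulmxA x0) XM.
have e0 u : (t <= u)%O -> ~ Q u -> e t *m X t u = 0.
  move=> tu nQ; rewrite et -mulmxA XM //.
  by have [->|Xu] := eqVneq (X r1 u) 0; [rewrite mulmx0 | case: nQ].
have p0 s : (s <= t)%O -> ~ P s -> X s t *m p t = 0.
  move=> st nP.
  by have [->|Xs] := eqVneq (X s t) 0; [rewrite mul0mx | case: nP].
pose J : set I := P `|` Q.
(* [P] and [Q] meet only in [t], where both recipes agree, so the order of the case distinction is
   immaterial to the values. *)
pose e' s : 'rV_(r s) := if `[< P s >] then e s else if `[< Q s >] then e t *m X t s else 0.
pose p' s : 'cV_(r s) := if `[< Q s >] then p s else if `[< P s >] then X s t *m p t else 0.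
have eQ s : (t <= s)%O -> e' s = e t *m X t s.
  move=> ts; rewrite /e'; case: asboolP => [Ps|_].
    have /eqP ts' : t == s by rewrite eq_le ts Ps.1.
    by case: _ / ts'; rewrite ett.
  by case: asboolP => // nQ; rewrite e0.
have eP' s : P s -> e' s = e s by move=> Ps; rewrite /e' asboolT.
have pP' s : (s <= t)%O -> p' s = X s t *m p t.
  move=> ts; rewrite /p'; case: asboolP => [Qs|_].
    have /eqP ts' : t == s by rewrite eq_le ts Qs.1.
    by case: _ / ts'; rewrite ptt.
  by case: asboolP => // nP; rewrite p0.
have pQ s : Q s -> p' s = p s by move=> Ps; rewrite /p' asboolT.
exists J, e', p'; split; first by exists t; left.
split.
- move=> u v w Ju Jv uw wv; have [wt|tw] := leP w t.
    left; case: Ju => [Pu|[tu _]]; first exact: P_up Pu uw wt.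
    by rewrite (_ : w = t) //; apply/le_anti; rewrite wt (le_trans tu uw).
  right; case: Jv => [[vt _]|Qv]; last exact: Q_down wv (ltW tw).
  by move: (lt_le_trans tw wv); rewrite ltNge vt.
- move=> s /not_orP[nP nQ]; rewrite /e' /p'.
  by rewrite !(asboolF nP) !(asboolF nQ).
- move=> s [Ps|Qs].
    rewrite eP' // pP' ?(Ps.1) // mulmxA.
    by rewrite (eP _ _ Ps Pt Ps.1).
  rewrite pQ // eQ ?(Qs.1) // -mulmxA.
  by rewrite (pP _ _ Qt Qs Qs.1).
- move=> s s' ss' [Ps|Qs]; last first.
    have ts := Qs.1.
    by rewrite !eQ ?(le_trans ts) // -mulmxA XM.
  rewrite eP' //; have [s't|ts'] := leP s' t.
    have Ps' := P_up _ _ Ps ss' s't.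
    by rewrite eP' // (eP _ _ Ps Ps' ss').
  rewrite eQ ?ltW // -(XM s t s') ?(ltW ts') ?Ps.1 //.
  by rewrite mulmxA (eP _ _ Ps Pt Ps.1).
- move=> s s' ss' [Ps'|Qs'].
    have s't := Ps'.1.
    by rewrite !pP' ?(le_trans ss') // mulmxA XM.
  rewrite pQ //; have [ts|st] := leP t s.
    have Qs := Q_down _ _ Qs' ss' ts.
    by rewrite pQ // (pP _ _ Qs Qs' ss').
  rewrite pP' ?ltW // -(XM s t s') ?(ltW st) ?Qs'.1 //.
  by rewrite -mulmxA (pP _ _ Qt Qs' Qs'.1).
Qed.
End IntervalPairs.

Lemma eq_sum_support (V : nmodType) (L : eqType) (s1 s2 : seq L) (F : L -> V) :
  uniq s1 -> uniq s2 -> (forall l, F l != 0 -> (l \in s1) = (l \in s2)) ->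
  \sum_(l <- s1) F l = \sum_(l <- s2) F l.
Proof.
move=> us1 us2 sF.
have supp s : \sum_(l <- s) F l = \sum_(l <- [seq l <- s | F l != 0]) F l.
  rewrite big_filter [LHS](bigID (fun l => F l != 0)) /= [X in _ + X]big1 ?addr0 //.
  by move=> l /negPn/eqP.
rewrite (supp s1) (supp s2); apply: perm_big; apply: uniq_perm; rewrite ?filter_uniq //.
by move=> l; rewrite !mem_filter; case: (boolP (F l != 0)) => //= /sF.
Qed.

(** A duplicate-free list of maximal length inside [D] must exhaust it. *)
Lemma enum_bounded (L : eqType) (D : set L) (n : nat) :
  (forall s, uniq s -> (forall l, l \in s -> D l) -> (size s <= n)%N) ->
  exists s, uniq s /\ forall l, l \in s <-> D l.
Proof.
move=> Dn.
have [||s [[us sD] smax]] := @exists_maximizer (seq L)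
  (fun s => uniq s /\ forall l, l \in s -> D l) size n [::]; [|by []|].
  by move=> s [us sD]; apply: Dn.
exists s; split=> // l; split; first exact: sD.
move=> Dl; apply: contrapT => /negP nls.
have := smax (l :: s); rewrite /= ltnn => /(_ _)/notF; apply; split.
  by rewrite nls.
by move=> l'; rewrite inE => /orP[/eqP->|/sD].
Qed.

(** * Decomposition of a regular system into interval summands *)

Section Decomposition.
Variables (d : Order.disp_t) (I : orderType d) (r : I -> nat).
Variable X : forall a b, 'M[int]_(r a, r b).
Hypotheses (Xsys : regular_system X) (X1 : forall a, X a a = 1%:M).

Record summand := Summand {
  sJ : set I; se : forall s, 'rV[int]_(r s); sp : forall s, 'cV[int]_(r s);
  sJ0 : sJ !=set0; sP : interval_pair X sJ se sp
}.

(** Vacuous on the diagonal, so that every summand is admissible for [maximal_pairwise]; symmetry is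
    obtained there by asking for both orders. *)
Definition sorth (x y : summand) := x <> y -> forall s, se x s *m sp y s = 0.

Section Complement.
Variable A : set summand.
Hypothesis Aorth : forall x y, A x -> A y -> sorth x y.
Local Notation L := {classic {x | A x}}.
Let J (l : L) := sJ (sval l).
Let e (l : L) := se (sval l).
Let p (l : L) := sp (sval l).

Let orth k l s : k != l -> e k s *m p l s = 0.
Proof.
move=> /eqP kl; apply: Aorth; [exact: svalP | exact: svalP | move=> klE].
by apply: kl; case: (k) (l) klE => x Ax [y Ay] /= xy; exact: eq_exist.
Qed.

Let out l s : ~ J l s -> e l s = 0 /\ p l s = 0.
Proof. by case: (sP (sval l)) => _ + _ _ _; apply. Qed.

Let ep1 l s : J l s -> e l s *m p l s = 1%:M.
Proof. by case: (sP (sval l)) => _ _ + _ _; apply. Qed.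

(** The generators and retractions of [k] orthogonal summands alive at [s] form matrices whose
    product is the identity of size [k]; it factors through rank [r s], so [k] is at most [r s]. *)
Lemma summands_at s : exists ls : seq L, uniq ls /\ forall l, l \in ls <-> J l s.
Proof.
apply: (@enum_bounded _ _ (r s)) => ls uls lsJ.
pose E := \matrix_(i < size ls) e (tnth (in_tuple ls) i) s.
pose P := \matrix_(i < r s, j < size ls) p (tnth (in_tuple ls) j) s i 0.
apply: (@mulmx1_min _ _ _ E P); apply/matrixP => i j.
have -> : (E *m P) i j = (e (tnth (in_tuple ls) i) s *m p (tnth (in_tuple ls) j) s) 0 0.
  by rewrite !mxE; apply: eq_bigr => k _; rewrite !mxE.
rewrite [RHS]mxE; case: (eqVneq i j) => [->|ij].
  by rewrite ep1 ?mxE //; apply/lsJ/mem_tnth.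
have kl : tnth (in_tuple ls) i != tnth (in_tuple ls) j.
  by rewrite (inj_eq (tuple_uniqP (in_tuple ls) uls)).
by rewrite (orth s kl) mxE.
Qed.

(** [q s] is the idempotent projecting along the finitely many summands alive at [s]. It commutes
    with the structure maps because each summand does. *)
Lemma complement : exists q : forall s, 'M[int]_(r s),
  [/\ forall l s, e l s *m q s = 0, forall l s, q s *m p l s = 0,
      forall a b, (a <= b)%O -> q a *m X a b = X a b *m q b,
      forall s, q s *m q s = q s
    & forall s, exists ls : seq L, [/\ uniq ls, forall l, l \in ls <-> J l s
        & q s = 1%:M - \sum_(l <- ls) p l s *m e l s]].
Proof.
pose ls s := sval (cid (summands_at s)).
have uls s : uniq (ls s) by exact: (svalP (cid (summands_at s))).1.
have lsP s l : l \in ls s <-> J l s by exact: (svalP (cid (summands_at s))).2.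
pose q s : 'M[int]_(r s) := 1%:M - \sum_(l <- ls s) p l s *m e l s.
have eq0 k s : e k s *m q s = 0.
  rewrite mulmxBr mulmx1 mulmx_sumr; have [Jks|nJks] := pselect (J k s).
    rewrite (bigD1_seq k) //=; last exact/lsP.
    rewrite mulmxA ep1 // mul1mx big1 ?addr0 ?subrr // => l lk.
    by rewrite mulmxA orth ?mul0mx // eq_sym.
  by rewrite (out nJks).1 big1 ?subrr // => l _; rewrite mul0mx.
have q0 k s : q s *m p k s = 0.
  rewrite mulmxBl mul1mx mulmx_suml; have [Jks|nJks] := pselect (J k s).
    rewrite (bigD1_seq k) //=; last exact/lsP.
    rewrite -mulmxA ep1 // mulmx1 big1 ?addr0 ?subrr // => l lk.
    by rewrite -mulmxA orth ?mulmx0.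
  by rewrite (out nJks).2 big1 ?subrr // => l _; rewrite mulmx0.
exists q; split=> //; last by move=> s; exists (ls s); split.
  move=> a b ab; rewrite /q mulmxBl mulmxBr mul1mx mulmx1; congr (_ - _).
  rewrite mulmx_suml mulmx_sumr.
  (* Both composites reduce to the sum of [p l a *m e l b], in which only summands alive at both [a]
     and [b] contribute. *)
  transitivity (\sum_(l <- ls a) p l a *m e l b).
    rewrite big_seq_cond [RHS]big_seq_cond; apply: eq_bigr => l; rewrite andbT => /lsP Jla.
    by have [_ _ _ /(_ _ _ ab Jla) h _] := sP (sval l); rewrite -mulmxA h.
  transitivity (\sum_(l <- ls b) p l a *m e l b); last first.
    rewrite big_seq_cond [RHS]big_seq_cond; apply: eq_bigr => l; rewrite andbT => /lsP Jlb.
    by have [_ _ _ _ /(_ _ _ ab Jlb) h] := sP (sval l); rewrite mulmxA h.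
  apply: eq_sum_support => // l pe0.
  have [Jla|nJla] := pselect (J l a); last by rewrite (out nJla).2 mul0mx eqxx in pe0.
  have [Jlb|nJlb] := pselect (J l b); last by rewrite (out nJlb).1 mulmx0 eqxx in pe0.
  by rewrite ((lsP _ _).2 Jla) ((lsP _ _).2 Jlb).
move=> s; rewrite {1}/q mulmxBl mul1mx mulmx_suml big1 ?subr0 // => l _.
by rewrite -mulmxA eq0 mulmx0.
Qed.
End Complement.

(** If the complement of a maximal orthogonal family were nonzero, it would contain a further
    interval summand orthogonal to the family. *)
Theorem regular_decomposition : exists (L : choiceType) (J : L -> set I)
    (e : forall (l : L) s, 'rV[int]_(r s)) (p : forall (l : L) s, 'cV[int]_(r s)),
  [/\ forall l, J l !=set0, forall l, interval_pair X (J l) (e l) (p l),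
      forall k l s, k != l -> e k s *m p l s = 0
    & forall s, exists ls : seq L, [/\ uniq ls, forall l, l \in ls <-> J l s
        & 1%:M = \sum_(l <- ls) p l s *m e l s]].
Proof.
have [XM Xreg] := Xsys.
have [//|A [_ Aorth Amax]] := @maximal_pairwise summand sorth set0.
have [q [eq0 q0 qX qq qE]] := complement Aorth.
have q1 s : q s = 0.
  apply: contrapT => /eqP qs0.
  (* The complement is kept on the same ranks, with the idempotent [q a] in place of the identity at
     [a]. *)
  pose X' a b := q a *m X a b.
  have X'sys : regular_system X'.
    split=> [a b c ab bc|a b ab].
      by rewrite /X' mulmxA -(mulmxA (q a)) -qX // mulmxA qq -mulmxA XM.
    have [G XG] := Xreg _ _ ab; exists G.
    transitivity (q a *m (X a b *m G *m X a b) *m q b); first by rewrite /X' {2}qX // !mulmxA.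
    by rewrite XG -mulmxA -qX // mulmxA qq.
  have [|J [e [p [J0 [Jitv out ep eX Xp]]]]] := @exists_interval_pair _ _ _ X' s X'sys.
    by rewrite /X' X1 mulmx1.
  have eq s' : e s' *m q s' = e s'.
    have [Js|nJs] := pselect (J s'); last by rewrite (out _ nJs).1 mul0mx.
    by rewrite -[RHS](eX _ _ (lexx s') Js) /X' X1 mulmx1.
  have qp s' : q s' *m p s' = p s'.
    have [Js|nJs] := pselect (J s'); last by rewrite (out _ nJs).2 mulmx0.
    by rewrite -[RHS](Xp _ _ (lexx s') Js) /X' X1 mulmx1.
  have zP : interval_pair X J e p.
    split=> // [u v uv Ju|u v uv Jv]; first by rewrite -(eX _ _ uv Ju) /X' mulmxA eq.
    by rewrite -(Xp _ _ uv Jv) /X' qX // -mulmxA qp.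
  (* The new pair is fixed by [q], which kills the whole family; by maximality it belongs to the
     family, so it is killed too, against [e p = 1]. *)
  have Az : A (Summand J0 zP).
    apply: Amax => // x Ax; split=> _ s' /=.
      by rewrite -qp mulmxA (eq0 (exist _ x Ax)) mul0mx.
    by rewrite -eq -mulmxA (q0 (exist _ x Ax)) mulmx0.
  have [u Ju] := J0; have := ep _ Ju.
  have := eq0 (exist _ _ Az) u; rewrite /= eq => ->.
  by rewrite mul0mx => /matrixP/(_ 0 0)/eqP; rewrite !mxE.
exists {classic {x | A x}}, (fun l => sJ (sval l)), (fun l => se (sval l)), (fun l => sp (sval l)).
split=> [l|l|k l s kl|s]; first exact: sJ0.
- exact: sP.
- move/eqP: kl => kl; apply: Aorth; [exact: svalP | exact: svalP | move=> klE].
  by apply: kl; case: (k) (l) klE => x Ax [y Ay] /= xy; exact: eq_exist.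
- have [ls [uls lsJ qsE]] := qE s; exists ls; split=> //.
  by apply/esym/eqP; rewrite -subr_eq0 -oppr_eq0 opprB -qsE q1.
Qed.
End Decomposition.

(** * Finitely generated free abelian groups *)

Section LinearCombination.
Variables (A : nzRingType) (V : lmodType A) (m : nat) (v : 'I_m -> V).

Definition lincomb (x : 'rV[A]_m) : V := \sum_i x 0 i *: v i.

Lemma lincomb_linear : linear lincomb.
Proof.
move=> a x y; rewrite /lincomb scaler_sumr -big_split; apply: eq_bigr => i _.
by rewrite !mxE scalerDl scalerA.
Qed.
HB.instance Definition _ := GRing.isLinear.Build A 'rV[A]_m V _ lincomb lincomb_linear.

Lemma lincomb_delta i : lincomb (delta_mx 0 i) = v i.
Proof.
rewrite /lincomb (bigD1 i) //= mxE !eqxx scale1r big1 ?addr0 // => j ji.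
by rewrite mxE eqxx (negbTE ji) scale0r.
Qed.
End LinearCombination.

Lemma eq_rowlinear (A : nzRingType) (V : lmodType A) m (f g : {linear 'rV[A]_m -> V}) :
  (forall i, f (delta_mx 0 i) = g (delta_mx 0 i)) -> f =1 g.
Proof.
move=> fg x; rewrite [x]matrix_sum_delta !linear_sum; apply: eq_bigr => i _.
rewrite !linear_sum; apply: eq_bigr => j _.
by rewrite !linearZ /= !ord1 fg.
Qed.

Lemma finitely_generatedP (A : nzRingType) (V : lmodType A) : finitely_generated V <->
  exists m (g : {linear 'rV[A]_m -> V}), forall v, exists x, v = g x.
Proof.
split=> [[s sV]|[m [g gV]]].
  exists (size s), (lincomb (fun i : 'I_(size s) => s`_i)) => v.
  have [c ->] := sV v; exists (\row_i c i).
  by rewrite /= /lincomb; apply: eq_bigr => i _; rewrite mxE.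
pose s := [seq g (delta_mx 0 i) | i <- enum 'I_m].
have sz : size s = m by rewrite size_map size_enum_ord.
exists s => v; have [x ->] := gV v; exists (fun i => x 0 (cast_ord sz i)).
rewrite [x in LHS]matrix_sum_delta big_ord1 linear_sum /=.
rewrite (reindex (cast_ord sz)) /=; last first.
  by apply: onW_bij; exists (cast_ord (esym sz)) => i; rewrite ?cast_ordK ?cast_ordKV.
apply: eq_bigr => i _; rewrite linearZ; congr (_ *: _).
rewrite (nth_map (cast_ord sz i)) ?size_enum_ord -?sz //=.
congr (g (delta_mx _ _)); apply: val_inj; rewrite /= nth_enum_ord //.
by rewrite -[X in (_ < X)%N]sz.
Qed.

Definition torsion_free (V : lmodType int) :=
  forall (a : int) (v : V), a *: v = 0 -> a = 0 \/ v = 0.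

Lemma torsion_free_inj (V W : lmodType int) (f : {linear V -> W}) :
  (forall v, f v = 0 -> v = 0) -> torsion_free W -> torsion_free V.
Proof.
move=> f0 WT a v av0; have [|->|/f0] := WT a (f v); [|by left|by right].
by rewrite -linearZ av0 linear0.
Qed.

Lemma freeg_torsion_free (B : choiceType) : torsion_free {freeg B / int}.
Proof.
move=> a x /eqP/freeg_eqP ax0; have [->|a0] := eqVneq a 0; [by left|right].
apply/eqP/freeg_eqP => b; have := ax0 b; rewrite coeffZ !coeff0 => /eqP.
by rewrite mulf_eq0 (negbTE a0) => /eqP.
Qed.

Lemma row_torsion_free n : torsion_free 'rV[int]_n.
Proof.
move=> a x ax0; have [->|a0] := eqVneq a 0; [by left|right].
apply/rowP => i; have /rowP/(_ i)/eqP := ax0.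
by rewrite !mxE mulf_eq0 (negbTE a0) => /eqP.
Qed.

Lemma free_torsion_free (V : lmodType int) : free_module V -> torsion_free V.
Proof.
move=> [B [f [g fK gK]]] a v av0.
have [|->|gv0] := @freeg_torsion_free B a (g v); [|by left|].
  by apply: (can_inj fK); rewrite linearZ /= gK av0 linear0.
by right; rewrite -(gK v) gv0 linear0.
Qed.

Definition fin_free (A : nzRingType) (V : lmodType A) :=
  exists n (f : {linear V -> 'rV[A]_n}) (g : {linear 'rV[A]_n -> V}),
    cancel f g /\ cancel g f.

Lemma can_linear (A : nzRingType) (V W : lmodType A) (f : {linear V -> W}) (g : W -> V) :
  cancel f g -> cancel g f -> linear g.
Proof. by move=> fK gK a x y; apply: (can_inj fK); rewrite linearP !gK. Qed.

(** With only 0 counted as trivial, [reduce_generators] ends with generators satisfying no relation,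
    that is, a basis. *)
Lemma torsion_free_fin_free (V : lmodType int) :
  finitely_generated V -> torsion_free V -> fin_free V.
Proof.
move=> /finitely_generatedP[m [g gV]] VT.
have [|n [h [P [Q [gP hQ h0]]]]] := @reduce_generators V (fun a => a = 0) _ VT _ g.
  by move=> a b ->; rewrite mul0r.
have hV v : exists x, v = h x by have [x ->] := gV v; exists (x *m P).
have [f fP] := choice hV.
have hK : cancel h f.
  move=> x; apply/eqP; rewrite -subr_eq0; apply/eqP/rowP => i; rewrite [RHS]mxE.
  by apply: h0; rewrite linearB -fP subrr.
have fK : cancel f h by move=> v; rewrite -fP.
have fL := can_linear hK fK.
pose f' := HB.pack f (GRing.isLinear.Build int V 'rV[int]_n _ f fL) : {linear V -> 'rV[int]_n}.
by exists n, f', h.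
Qed.

Lemma fin_free_fg (A : nzRingType) (V : lmodType A) : fin_free V -> finitely_generated V.
Proof.
move=> [n [f [g [fK gK]]]]; apply/finitely_generatedP; exists n, g => v.
by exists (f v); rewrite fK.
Qed.

Lemma fin_free_free (A : nzRingType) (V : lmodType A) : fin_free V -> free_module V.
Proof.
move=> [n [f [g [fK gK]]]]; pose b (i : 'I_n) := g (delta_mx 0 i).
exists 'I_n, (fglift b).
pose h x : {freeg 'I_n / A} := lincomb (fun i => << i >>) (f x).
exists h => [x|v].
  apply: (eq_freeg (f := lincomb (fun i => << i >>) \o f \o fglift b) (g := idfun)) => i.
  by rewrite /= liftU scale1r gK lincomb_delta.
rewrite -[RHS]fK; apply: (eq_rowlinear (f := fglift b \o lincomb (fun i => << i >>))) => i.
by rewrite /= lincomb_delta liftU scale1r.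
Qed.

Lemma fin_free_torsion_free (V : lmodType int) : fin_free V -> torsion_free V.
Proof.
move=> [n [f [g [fK _]]]]; apply: (torsion_free_inj (f := f)) (@row_torsion_free n) => v fv0.
by rewrite -(fK v) fv0 linear0.
Qed.

Lemma fg_freeP (V : lmodType int) : finitely_generated V ->
  free_module V <-> torsion_free V.
Proof.
move=> Vfg; split; first exact: free_torsion_free.
by move=> /(torsion_free_fin_free Vfg)/fin_free_free.
Qed.

(** * Universal coefficients *)

Section HomologyClasses.
Variables (A : nzRingType) (C : complex A).

Lemma bd_cycle n (w : C n.+1) : @cycle_pred A C n (bd C w).
Proof. by case: n w => [//|n] w; apply/eqP; rewrite bd_bd. Qed.

Lemma hclass_eq0 n (z : cycles C n) : hclass C n z = 0 <-> exists w, bd C w = val z.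
Proof.
rewrite -(linear0 (hclass C n)); split=> [/eqP|[w wz]].
  by rewrite modpi_eq subr0 => /asboolP.
by apply/eqP; rewrite modpi_eq subr0; apply/asboolP; exists w.
Qed.

Lemma hclass_surj n (h : homology C n) : exists z, hclass C n z = h.
Proof. by elim/homologyW: h => z; exists z. Qed.

Lemma val_cycles_sum n (T : Type) (s : seq T) (F : T -> cycles C n) :
  val (\sum_(i <- s) F i) = \sum_(i <- s) val (F i).
Proof. exact: (raddf_sum (val : cycles C n -> C n)). Qed.
End HomologyClasses.

Section FieldIntegers.
Variable F : fieldType.

(** The witness is the characteristic of [F], a prime or 0. *)
Lemma field_annihilator : exists c : int, c%:~R = 0 :> F /\
  forall a : int, a%:~R = 0 :> F -> exists b, a = b * c.
Proof.
have [[n [n0 /eqP nF0]]|/forallNP nF] := pselect (exists n : nat, (0 < n)%N /\ n%:R = 0 :> F).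
  have [p pF] := natf0_pchar n0 nF0.
  exists p; split; first by apply/eqP; rewrite -(dvdz_pcharf pF) dvdzz.
  by move=> a /eqP; rewrite -(dvdz_pcharf pF) => /dvdzP.
exists 0; split=> // a /eqP a0; exists 0; rewrite mul0r.
have : `|a|%:R == 0 :> F.
  by move: a0; case: (intP a) => // m; rewrite ?mulrNz ?oppr_eq0 ?abszN absz_nat.
have [/eqP|a1 /eqP aF] := posnP `|a|%N; first by rewrite absz_eq0 => /eqP.
by case: (nF `|a|%N).
Qed.

(** [F] has no zero divisors, so [reduce_generators] applies to its additive group, and the
    remaining relations have all coefficients divisible by the characteristic. *)
Lemma coefficient_basis (ys : seq F) : exists k (x : 'I_k -> F),
  (forall y, y \in ys -> exists m : 'I_k -> int, y = \sum_i (m i)%:~R * x i) /\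
  forall m : 'I_k -> int, \sum_i (m i)%:~R * x i = 0 -> forall i, (m i)%:~R = 0 :> F.
Proof.
pose V : lmodType int := zmodule F.
have scE (a : int) (v : V) : a *: v = a%:~R * (v : F) by rewrite mulrzl.
pose g : {linear 'rV[int]_(size ys) -> V} := lincomb (fun i : 'I__ => ys`_i : V).
have [||k [h [P [Q [gP _ h0]]]]] := @reduce_generators V (fun a => a%:~R = 0 :> F) _ _ _ g.
- by move=> a b a0; rewrite intrM a0 mul0r.
- move=> a v; rewrite scE => /eqP; rewrite mulf_eq0 => /orP[/eqP|/eqP]; by [left | right].
have hE x : h x = \sum_i (x 0 i)%:~R * (h (delta_mx 0 i) : F).
  rewrite [in LHS](matrix_sum_delta x) big_ord1 linear_sum; apply: eq_bigr => i _.
  by rewrite linearZ; exact: scE.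
exists k, (fun i => h (delta_mx 0 i)); split=> [y yys|m].
  have iy : (index y ys < size ys)%N by rewrite index_mem.
  exists (fun i => ((delta_mx 0 (Ordinal iy) : 'rV_(size ys)) *m P) 0 i); rewrite -hE -gP.
  by rewrite /g /= lincomb_delta /= nth_index.
move=> m0 i; have := h0 (\row_i m i); rewrite hE => /(_ _ i); rewrite mxE; apply.
by rewrite -[RHS]m0; apply: eq_bigr => j _; rewrite mxE.
Qed.
End FieldIntegers.

Section TensorElements.
Variables (M : lmodType int) (F : nzRingType).

Lemma tensDl (m m' : M) (x : F) : tens (m + m') x = tens m x + tens m' x.
Proof. by case: (tens_balanced M F). Qed.
Lemma tensDr (m : M) (x x' : F) : tens m (x + x') = tens m x + tens m x'.
Proof. by case: (tens_balanced M F). Qed.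
Lemma tensZ (m : M) (a x : F) : tens m (a * x) = a *: tens m x.
Proof. by case: (tens_balanced M F). Qed.

Lemma tens0l (x : F) : tens (0 : M) x = 0.
Proof. by apply: (addrI (tens 0 x)); rewrite -tensDl !addr0. Qed.
Lemma tens0r (m : M) : tens m (0 : F) = 0.
Proof. by apply: (addrI (tens m 0)); rewrite -tensDr !addr0. Qed.

Lemma tens_suml (T : Type) (s : seq T) (m : T -> M) (x : F) :
  tens (\sum_(i <- s) m i) x = \sum_(i <- s) tens (m i) x.
Proof.
apply: (big_morph (fun m => tens m x)) => [m1 m2|]; [exact: tensDl|exact: tens0l].
Qed.

Lemma tens_sumr (T : Type) (s : seq T) (m : M) (x : T -> F) :
  tens m (\sum_(i <- s) x i) = \sum_(i <- s) tens m (x i).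
Proof.
apply: (big_morph (fun x => tens m x)) => [x1 x2|]; [exact: tensDr|exact: tens0r].
Qed.

Lemma tens_int (a : int) (m : M) (x : F) : tens (a *: m) x = tens m (a%:~R * x).
Proof.
have tN (n : M) (y : F) : tens (- n) y = - tens n y.
  by apply: (addrI (tens n y)); rewrite -tensDl !subrr tens0l.
have tNr (n : M) (y : F) : tens n (- y) = - tens n y.
  by apply: (addrI (tens n y)); rewrite -tensDr !subrr tens0r.
have tn (n : nat) : tens ((n%:Z) *: m) x = tens m (n%:~R * x).
  elim: n => [|n IHn].
    by rewrite scale0r mul0r tens0l tens0r.
  by rewrite -addn1 PoszD scalerDl scale1r tensDl IHn intrD mulrDl mul1r tensDr.
case: (intP a) => [|n|n]; [exact: (tn 0)|exact: tn|].
by rewrite scaleNr tN tn mulrNz mulNr tNr.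
Qed.

Lemma tensorW (t : tensor M F) : exists s : seq (M * F), t = \sum_(q <- s) tens q.1 q.2.
Proof.
elim/modpiW: t => t; elim/freegW: t => [|a [m x] t [s ts]].
  by exists [::]; rewrite big_nil linear0.
exists ((m, a * x) :: s); rewrite big_cons -ts linearD /= tensZ; congr (_ + _).
by rewrite /tens -linearZ freegZ mulr1.
Qed.
End TensorElements.

Section UniversalCoefficientTheorem.
Variables (R : realType) (F : fieldType) (X : topologicalType).
Local Notation CZ := (singular R int X).
Local Notation CF := (singular R F X).

Lemma freeg_sum_coeff (A : nzRingType) (B : choiceType) (x : {freeg B / A}) :
  x = \sum_(b <- dom x) coeff b x *: << b >>.
Proof.
by rewrite -[LHS]freeg_sumE; apply: eq_bigr => b _; rewrite freegZ mulr1.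
Qed.

Lemma coeff_sumZ (A : nzRingType) (B : choiceType) (T : Type) (s : seq T)
    (a : T -> A) (x : T -> {freeg B / A}) b :
  coeff b (\sum_(i <- s) a i *: x i) = \sum_(i <- s) a i * coeff b (x i).
Proof. by rewrite raddf_sum; apply: eq_bigr => i _; rewrite /= coeffZ. Qed.

Lemma coef_chainZ k (a : int) (c : CZ k) :
  (coef_chain R F X k (a *: c) : CF k) = a%:~R *: (coef_chain R F X k c : CF k).
Proof. by rewrite linearZ /= scalezrE scaler_int. Qed.

Lemma coef_chain_sum k (T : Type) (s : seq T) (a : T -> int) (x : T -> CZ k) :
  (coef_chain R F X k (\sum_(i <- s) a i *: x i) : CF k) =
  \sum_(i <- s) (a i)%:~R *: (coef_chain R F X k (x i) : CF k).
Proof.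
by rewrite linear_sum; apply: eq_bigr => i _; rewrite -coef_chainZ.
Qed.

Lemma coeff_coef_chain k (c : CZ k) (s : sing R X k) :
  coeff s (coef_chain R F X k c : CF k) = (coeff s (c : {freeg (sing R X _) / int}))%:~R.
Proof.
rewrite [in LHS](freeg_sum_coeff (c : {freeg (sing R X _) / int})).
rewrite [in RHS](freeg_sum_coeff (c : {freeg (sing R X _) / int})).
rewrite (@coef_chain_sum k _ _ _ (fun b => << b >>)) !coeff_sumZ rmorph_sum.
apply: eq_bigr => b _; rewrite rmorphM /= coef_chainU !coeffU.
by rewrite !mul1r rmorph_nat.
Qed.

(** All coefficients of [c] are multiples of the characteristic [p]. In characteristic zero [c]
    vanishes, and the last clause fixes the otherwise arbitrary quotient [e] as 0. *)
Lemma coef_chain_eq0 k (c : CZ k) : (coef_chain R F X k c : CF k) = 0 ->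
  exists (p : int) (e : CZ k), [/\ p%:~R = 0 :> F, c = p *: e & p = 0 -> e = 0].
Proof.
move=> c0; have [p [pF pdvd]] := field_annihilator F.
have [p0|p0] := eqVneq p 0.
  exists 0, 0; split=> //; rewrite scaler0; apply/eqP/freeg_eqP => s.
  have := coeff_coef_chain c s; rewrite c0 !coeff0 => /esym/pdvd[b ->].
  by rewrite p0 mulr0.
have divp s : exists b, coeff s (c : {freeg (sing R X _) / int}) = b * p.
  by apply: pdvd; rewrite -coeff_coef_chain c0 coeff0.
have [q qP] := choice divp.
exists p, (\sum_(s <- dom (c : {freeg (sing R X k) / int})) q s *: << s >>); split=> //.
  rewrite [LHS](freeg_sum_coeff (c : {freeg (sing R X _) / int})) scaler_sumr.
  by apply: eq_bigr => s _; rewrite scalerA qP mulrC.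
by move/eqP; rewrite (negbTE p0).
Qed.

Lemma bd_coef_sum k (m : nat) (x : 'I_m -> F) (c : 'I_m -> CZ k.+1) :
  bd CF (\sum_i x i *: (coef_chain R F X k.+1 (c i) : CF k.+1)) =
  \sum_i x i *: (coef_chain R F X k (bd CZ (c i)) : CF k).
Proof.
rewrite linear_sum; apply: eq_bigr => i _.
by rewrite linearZ; congr (_ *: _); exact: coef_chain_bd.
Qed.

(** Chain groups are torsion-free, so dividing a cycle by a nonzero integer leaves a cycle. *)
Lemma torsion_cycle n (z : cycles CZ n) (p : int) (e : CZ n) :
  val z = p *: e -> (p = 0 -> e = 0) -> @cycle_pred int CZ n e.
Proof.
case: n z e => [//|n] [z dz] e /= ze p0; have /eqP := dz; rewrite ze linearZ => pde.
apply/eqP; have [/p0 ->|//] := freeg_torsion_free pde; exact: linear0.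
Qed.

(* Writing the coefficients over a basis of the additive subgroup they generate
   turns a chain over [F] into a combination of integral chains, which vanishes
   only if each of them is a multiple of the characteristic. *)
Lemma integral_chains k (w : CF k) (ys : seq F) :
  exists m (x : 'I_m -> F),
  [/\ forall y, y \in ys -> exists a : 'I_m -> int, y = \sum_i (a i)%:~R * x i,
      exists c : 'I_m -> CZ k, w = \sum_i x i *: (coef_chain R F X k (c i) : CF k)
    & forall k' (c : 'I_m -> CZ k'),
        \sum_i x i *: (coef_chain R F X k' (c i) : CF k') = 0 ->
        forall i, (coef_chain R F X k' (c i) : CF k') = 0].
Proof.
pose D := dom (w : {freeg (sing R X k) / F}).
pose cs := [seq coeff s (w : {freeg (sing R X _) / F}) | s <- D].
have [m [x [xspan xind]]] := coefficient_basis (ys ++ cs).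
exists m, x; split=> [y yys||k' c c0 i].
- by apply: xspan; rewrite mem_cat yys.
- have sD s : exists a : 'I_m -> int, s \in D ->
      coeff s (w : {freeg (sing R X _) / F}) = \sum_i (a i)%:~R * x i.
    have [sD|] := boolP (s \in D); last by exists (fun=> 0).
    have [|a aP] := xspan (coeff s (w : {freeg (sing R X _) / F})); last by exists a.
    by rewrite mem_cat (map_f (fun s => coeff s (w : {freeg (sing R X _) / F})) sD) orbT.
  have [a aP] := choice sD.
  exists (fun i => \sum_(s <- D) a s i *: << s >>).
  rewrite [LHS](freeg_sum_coeff (w : {freeg (sing R X _) / F})).
  under [RHS]eq_bigr => i _ do
    rewrite (@coef_chain_sum k _ _ _ (fun b => << b >>)) scaler_sumr.
  rewrite exchange_big /= big_seq [RHS]big_seq; apply: eq_bigr => s sD'.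
  rewrite (aP s sD') scaler_suml; apply: eq_bigr => i _.
  by rewrite scalerA mulrC coef_chainU.
- apply/eqP/freeg_eqP => s; rewrite coeff_coef_chain coeff0.
  apply: (xind (fun i => coeff s (c i : {freeg (sing R X _) / int}))).
  rewrite -[RHS](coeff0 F s) -c0 coeff_sumZ; apply: eq_bigr => j _.
  by rewrite coeff_coef_chain mulrC.
Qed.

Lemma uctE n (s : seq (sing_homology R int X n * F)) :
  uct R F X n (\sum_(q <- s) tens q.1 q.2) =
  \sum_(q <- s) q.2 *: (coef_homology R F X n q.1 : sing_homology R F X n).
Proof. by rewrite linear_sum; apply: eq_bigr => q _; exact: tensor_liftE. Qed.

(** A chain over [F] bounding the image of [t] is split along independent coefficients [x i]. This
    writes [t] as a sum of [[u i]] tensored with [x i], where each cycle [u i] is [p] times a cycle;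
    moving [p] across the tensor sign kills every term. *)
Lemma uct_inj n (t : tensor (sing_homology R int X n) F) : uct R F X n t = 0 -> t = 0.
Proof.
have [s ->] := tensorW t; rewrite uctE.
have [z zP] := choice (@hclass_surj int CZ n).
pose cz h : CZ n := val (z h).
have -> : \sum_(q <- s) q.2 *: (coef_homology R F X n q.1 : sing_homology R F X n) =
    hclass CF n (\sum_(q <- s) q.2 *: coef_cycle F (z q.1)).
  rewrite linear_sum; apply: eq_bigr => q _.
  by rewrite -{1}(zP q.1) coef_homologyE linearZ.
move=> /hclass_eq0[w wE].
have [m [x [yspan [c cE] xind]]] := integral_chains w [seq q.2 | q <- s].
have {yspan}yq q : exists a : 'I_m -> int, q \in s -> q.2 = \sum_i (a i)%:~R * x i.
  have [qs|] := boolP (q \in s); last by exists (fun=> 0).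
  by have [a aE] := yspan _ (map_f snd qs); exists a.
have [a aP] := choice yq.
(* The component along [x i] of the relation saying that the cycle over [F] is the boundary of
   [w]. *)
pose u i : CZ n := \sum_(q <- s) a q i *: cz q.1 - bd CZ (c i).
have u0 i : (coef_chain R F X n (u i) : CF n) = 0.
  have sE : \sum_i x i *: (coef_chain R F X n (\sum_(q <- s) a q i *: cz q.1) : CF n) =
      \sum_(q <- s) q.2 *: (coef_chain R F X n (cz q.1) : CF n).
    under eq_bigr => j _ do rewrite coef_chain_sum scaler_sumr.
    rewrite exchange_big /= big_seq [RHS]big_seq; apply: eq_bigr => q qs.
    rewrite (aP q qs) scaler_suml; apply: eq_bigr => j _.
    by rewrite scalerA mulrC.
  move: i; apply: xind; rewrite /u.
  under eq_bigr => j _ do rewrite raddfB scalerBr.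
  rewrite sumrB sE -bd_coef_sum -cE wE val_cycles_sum; apply/eqP; rewrite subr_eq0; apply/eqP.
  by apply: eq_bigr => q qs; rewrite linearZ.
have uZ i : exists z' : cycles CZ n, val z' = u i /\
    hclass CZ n z' = \sum_(q <- s) a q i *: q.1.
  pose z1 := \sum_(q <- s) a q i *: z q.1.
  pose z2 : cycles CZ n := Submodule (bd_cycle (c i)).
  exists (z1 - z2); split.
    rewrite raddfB; congr (_ - _).
    transitivity (\sum_(q <- s) val (a q i *: z q.1)); first exact: val_cycles_sum.
    by apply: eq_bigr => q _; rewrite linearZ.
  rewrite raddfB /= (_ : hclass CZ n z2 = 0); last by apply/hclass_eq0; exists (c i).
  rewrite subr0 linear_sum; apply: eq_bigr => q _.
  by rewrite linearZ zP.
rewrite big_seq; under eq_bigr => q qs do rewrite [in X in tens _ X](aP q qs) tens_sumr.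
rewrite exchange_big /= big1 // => i _.
under eq_bigr do rewrite -tens_int.
rewrite -big_seq -tens_suml.
have [z' [z'u <-]] := uZ i.
have [p [e [pF ue p0]]] := coef_chain_eq0 (u0 i).
have ecyc := torsion_cycle (etrans z'u ue) p0.
have -> : z' = p *: (Submodule ecyc : cycles CZ n).
  by apply: val_inj; rewrite linearZ /= z'u.
by rewrite linearZ tens_int pF mul0r tens0r.
Qed.

(** A cycle over [F] is a combination of integral chains [c i] whose boundaries vanish in [F], hence
    have the form [p e] with [e] a cycle. The class of [e] is [p]-torsion, so [e] bounds some [g],
    and [c i - p g] is an integral cycle with the same reduction. *)
Lemma uct_surj n : (forall m, n = m.+1 -> torsion_free (sing_homology R int X m)) ->
  forall h, exists t, uct R F X n t = h.
Proof.
move=> Htf h; have [z <-] := hclass_surj h.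
have [m [x [_ [c cE] xind]]] := integral_chains (val z) [::].
have cyc i : exists z' : cycles CZ n,
    (coef_chain R F X n (val z') : CF n) = coef_chain R F X n (c i).
  case: n Htf h z c cE => [|n] Htf h z c cE.
    by exists (Submodule (isT : @cycle_pred int CZ 0 (c i)) : cycles CZ 0).
  have dz : bd CF (val z) = 0 by apply/eqP; exact: (valP z).
  have dc : (coef_chain R F X n (bd CZ (c i)) : CF n) = 0.
    by move: i; apply: xind; rewrite -bd_coef_sum -cE.
  have [p [e [pF de p0]]] := coef_chain_eq0 dc.
  have ecyc := torsion_cycle (z := Submodule (bd_cycle (c i))) de p0.
  pose z1 : cycles CZ n := Submodule ecyc.
  have pz1 : p *: hclass CZ n z1 = 0.
    by rewrite -linearZ; apply/hclass_eq0; exists (c i); rewrite de linearZ.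
  (* When [p = 0] torsion-freeness says nothing, but then [e = 0], which bounds. *)
  have [g gE] : exists g, bd CZ g = e.
    have [/p0 e0|/hclass_eq0//] := Htf _ erefl _ _ pz1.
    by exists 0; rewrite linear0 e0.
  have cyc : @cycle_pred int CZ n.+1 (c i - p *: g).
    by apply/eqP; rewrite linearB linearZ /= gE de subrr.
  exists (Submodule cyc : cycles CZ n.+1); rewrite /= [LHS]linearB.
  by rewrite [X in _ - X]coef_chainZ pF scale0r subr0.
have [z' z'P] := choice cyc.
exists (\sum_(i < m) tens (hclass CZ n (z' i)) (x i)).
rewrite linear_sum.
have -> : z = \sum_i x i *: coef_cycle F (z' i).
  apply: val_inj; rewrite cE val_cycles_sum; apply: eq_bigr => i _.
  by rewrite linearZ /= z'P.
rewrite linear_sum; apply: eq_bigr => i _.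
by rewrite linearZ -coef_homologyE; exact: tensor_liftE.
Qed.

End UniversalCoefficientTheorem.

(** * The relative homology group *)

Lemma modpi_eq0 (A : nzRingType) (V : lmodType A) (N : submodClosed V) x :
  modpi N x = 0 <-> x \in N.
Proof.
rewrite -(linear0 (modpi N)); split=> [/eqP|xN]; first by rewrite modpi_eq subr0.
by apply/eqP; rewrite modpi_eq subr0.
Qed.

Lemma fg_sum (A : nzRingType) (V : lmodType A) m1 m2 (g1 : {linear 'rV[A]_m1 -> V})
    (g2 : {linear 'rV[A]_m2 -> V}) :
  (forall v, exists x y, v = g1 x + g2 y) -> finitely_generated V.
Proof.
move=> gV; apply/finitely_generatedP.
exists (m1 + m2)%N, ((g1 \o lsubmx) \+ (g2 \o rsubmx)) => v.
by have [x [y ->]] := gV v; exists (row_mx x y); rewrite /= row_mxKl row_mxKr.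
Qed.

Lemma fg_surj (A : nzRingType) (V W : lmodType A) (f : {linear V -> W}) :
  (forall w, exists v, w = f v) -> finitely_generated V -> finitely_generated W.
Proof.
move=> fW /finitely_generatedP[m [g gV]]; apply/finitely_generatedP.
exists m, (f \o g) => w; have [v ->] := fW w; have [x ->] := gV v.
by exists x.
Qed.

(* The image of [f] is free, so the kernel is a direct summand. *)
Lemma kernel_generators (V W : lmodType int) (f : {linear V -> W}) :
  finitely_generated V -> torsion_free W ->
  exists m (k : {linear 'rV[int]_m -> V}), forall v, f v = 0 <-> exists x, v = k x.
Proof.
move=> /finitely_generatedP[m [g gV]] Wtf.
have [a b ->|n [h [P [Q [gP hQ h0]]]]] :=
  @reduce_generators W (fun a => a = 0) _ Wtf _ (f \o g); first by rewrite mul0r.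
have hinj x : h x = 0 -> x = 0 by move=> /h0 hx; apply/rowP => j; rewrite hx mxE.
(* [P Q] lifts the image of [f] back to the generators, so [1 - P Q] maps every vector into the
   kernel and fixes those with [x P = 0]. *)
exists m, (g \o mulmxr (1%:M - P *m Q)) => v; split=> [|[x ->]].
  have [x ->] := gV v; rewrite [f _]gP => /hinj xP; exists x.
  by rewrite /= mulmxBr mulmx1 mulmxA xP mul0mx subr0.
rewrite /= mulmxBr mulmx1 mulmxA linearB linearB /= -[f (g (_ *m Q))]hQ.
by rewrite [f (g x)]gP subrr.
Qed.

(** The image is a pure subgroup. Conditions (2) and (3) and the decomposability condition are all
    compared through this elementwise form. *)
Definition saturated (V W : lmodType int) (f : {linear V -> W}) :=
  forall (a : int) v w, a != 0 -> a *: w = f v -> exists v', w = f v'.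

Lemma coker_torsion_free (V W : lmodType int) (f : {linear V -> W}) :
  torsion_free (coker f) <-> saturated f.
Proof.
have imP w : w \in imm f <-> exists v, w = f v.
  by split=> [/asboolP[v <-]|[v ->]]; [exists v|apply/asboolP; exists v].
split=> [ctf a v w a0 aw|fsat a].
  have [|/eqP|/modpi_eq0/imP//] := ctf a (modpi (imm f) w).
    by rewrite -linearZ; apply/modpi_eq0/imP; exists v.
  by rewrite (negbTE a0).
elim/modpiW => w; rewrite -linearZ => /modpi_eq0/imP[v aw].
have [->|a0] := eqVneq a 0; [by left|right].
by apply/modpi_eq0/imP; exact: fsat aw.
Qed.

Lemma coker_free (V W : lmodType int) (f : {linear V -> W}) :
  finitely_generated W -> free_module (coker f) <-> saturated f.
Proof.
move=> Wfg; rewrite -coker_torsion_free; apply/fg_freeP.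
apply: (fg_surj (f := modpi (imm f))) Wfg; elim/modpiW => w; by exists w.
Qed.

(** * The long exact sequence of an injective chain map *)

Section LongExactSequence.
Variables (C D : complex int) (f : chain_map C D).
Hypothesis f_inj : forall n x, f n x = 0 -> x = 0.
Local Notation E := (coker_complex f).
Definition coker_pr n : {linear D n -> E n} := modpi (imm (f n)).
Local Notation pr := coker_pr.

Lemma coker_proj_bd n (x : D n.+1) : pr n (bd D x) = bd E (pr n.+1 x).
Proof. exact/esym/coker_bdE. Qed.
Definition coker_proj : chain_map D E := @ChainMap _ D E coker_pr coker_proj_bd.

Lemma pr_eq0 n (y : D n) : pr n y = 0 <-> exists x, y = f n x.
Proof.
rewrite modpi_eq0; split=> [/asboolP[x <-]|[x ->]]; first by exists x.
by apply/asboolP; exists x.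
Qed.

Lemma cycle_reflect n (c : C n) : @cycle_pred int D n (f n c) -> @cycle_pred int C n c.
Proof.
case: n c => [//|n] c /eqP fc; apply/eqP/f_inj.
by rewrite cmap_bd.
Qed.

(** Exactness at the homology of [D]: a relative boundary differs from a boundary of [D] by a chain
    of [C], which is a cycle since [f] is injective. *)
Lemma coker_proj_ker n (y : homology D n) :
  homology_map coker_proj n y = 0 <-> exists x, y = homology_map f n x.
Proof.
split=> [|[x ->]].
  have [z <-] := hclass_surj y; rewrite homology_mapE => /hclass_eq0[w].
  elim/modpiW: w => w wz.
  have [c zc] : exists c, val z - bd D w = f n c.
    by apply/pr_eq0; rewrite linearB coker_proj_bd wz subrr.
  have ccyc : @cycle_pred int C n c.
    by apply: cycle_reflect; rewrite -zc; exact: (valP (z - Submodule (bd_cycle w))).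
  exists (hclass C n (Submodule ccyc)); rewrite homology_mapE.
  apply/eqP; rewrite -subr_eq0 -linearB; apply/eqP/hclass_eq0; exists w.
  by rewrite raddfB /= -zc opprB addrC subrK.
have [z <-] := hclass_surj x; rewrite !homology_mapE; apply/hclass_eq0.
exists 0; rewrite linear0; apply/esym/pr_eq0.
by exists (val z).
Qed.

(** The connecting homomorphism as a relation, which carries the zigzag along instead of choosing
    lifts. It is total by [connecting_ex], and single-valued by [connecting_linear] and
    [connecting_fun0]. *)
Variant connecting n (h : homology E n.+1) (k : homology C n) : Prop :=
  Connecting (u : cycles E n.+1) (z : D n.+1) (c : cycles C n) of
    hclass E _ u = h & val u = pr _ z & bd D z = f n (val c) & hclass C n c = k.

Lemma connecting_linear n (a : int) (h h' : homology E n.+1) (k k' : homology C n) :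
  connecting h k -> connecting h' k' -> connecting (a *: h + h') (a *: k + k').
Proof.
move=> [u z c <- uz zc <-] [u' z' c' <- uz' zc' <-].
by exists (a *: u + u') (a *: z + z') (a *: c + c'); rewrite ?linearP //= ?uz ?uz' ?zc ?zc' ?linearP.
Qed.

Lemma connecting0 n : @connecting n 0 0.
Proof.
by exists 0 0 0; rewrite ?linear0.
Qed.

Lemma connecting_sum n m (x : 'I_m -> int) (h : 'I_m -> homology E n.+1)
    (k : 'I_m -> homology C n) : (forall i, connecting (h i) (k i)) ->
  connecting (\sum_i x i *: h i) (\sum_i x i *: k i).
Proof.
move=> hk; apply: (big_ind2 (@connecting n)) => [|h1 k1 h2 k2 hk1 hk2|i _].
- exact: connecting0.
- by rewrite -[h1]scale1r -[k1]scale1r; exact: connecting_linear.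
- by rewrite -[_ *: h i]addr0 -[_ *: k i]addr0; apply: connecting_linear => //; exact: connecting0.
Qed.

Lemma connecting_ex n (h : homology E n.+1) : exists k, connecting h k.
Proof.
have [u uh] := hclass_surj h; have [z zu] : exists z, pr _ z = val u.
  by elim/modpiW: (val u) => z; exists z.
have [c cz] : exists c, bd D z = f n c.
  by apply/pr_eq0; rewrite coker_proj_bd zu; apply/eqP; exact: (valP u).
have ccyc : @cycle_pred int C n c by apply: cycle_reflect; rewrite -cz; exact: bd_cycle.
by exists (hclass C n (Submodule ccyc)); exists u z (Submodule ccyc).
Qed.

(** Exactness at the homology of [C]. *)
Lemma connecting_ker n (k : homology C n) :
  homology_map f n k = 0 <-> exists h, connecting h k.
Proof.
split=> [|[h [u z c _ _ zc <-]]].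
  have [c <-] := hclass_surj k; rewrite homology_mapE => /hclass_eq0[z zc].
  have ucyc : @cycle_pred int E n.+1 (pr _ z).
    by apply/eqP; rewrite -coker_proj_bd; apply/pr_eq0; exists (val c).
  by exists (hclass E n.+1 (Submodule ucyc)); exists (Submodule ucyc) z c.
by rewrite homology_mapE; apply/hclass_eq0; exists z.
Qed.

(** Exactness at the relative group: if the connecting class bounds [c'] in [C], subtracting [f c']
    turns the lift into a cycle of [D]. *)
Lemma connecting_eq0 n (h : homology E n.+1) :
  connecting h 0 -> exists y, h = homology_map coker_proj n.+1 y.
Proof.
move=> [u z c <- uz zc /hclass_eq0[c' cc']].
have zcyc : @cycle_pred int D n.+1 (z - f n.+1 c').
  by apply/eqP; rewrite linearB /= -cmap_bd cc' zc subrr.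
exists (hclass D n.+1 (Submodule zcyc)); rewrite homology_mapE; congr (hclass E _ _).
apply: val_inj; rewrite uz /= linearB /= [X in _ - X](_ : _ = 0) ?subr0 //.
by apply/pr_eq0; exists c'.
Qed.

Lemma connecting_fun0 n (k : homology C n) : connecting 0 k -> k = 0.
Proof.
move=> [u z c /hclass_eq0[w wu] uz zc <-].
elim/modpiW: w wu => w wu.
have [c' c'E] : exists c', z - bd D w = f n.+1 c'.
  by apply/pr_eq0; rewrite linearB coker_proj_bd wu uz subrr.
apply/hclass_eq0; exists c'; apply/eqP; rewrite -subr_eq0; apply/eqP/f_inj.
by rewrite linearB cmap_bd -c'E linearB /= bd_bd subr0 zc subrr.
Qed.

(** In positive degree, generators are the images of those of the homology of [D] together with
    lifts of generators of the kernel one degree lower. *)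
Lemma relative_fg n : finitely_generated (homology D n) ->
  (forall m, n = m.+1 -> finitely_generated (homology C m) /\ torsion_free (homology D m)) ->
  finitely_generated (homology E n).
Proof.
case: n => [|n] Dfg CDn.
  apply: (fg_surj (f := homology_map coker_proj 0)) Dfg => h.
  have [u <-] := hclass_surj h; have [z zu] : exists z, pr _ z = val u.
    by elim/modpiW: (val u) => z; exists z.
  exists (hclass D 0 (Submodule (isT : @cycle_pred int D 0 z))).
  by rewrite homology_mapE; congr (hclass E _ _); apply: val_inj; rewrite -zu.
have [Cfg Dtf] := CDn _ erefl.
have [m [k kP]] := @kernel_generators _ _ (homology_map f n) Cfg Dtf.
have hex i : exists h, connecting h (k (delta_mx 0 i)).
  by apply/connecting_ker/kP; exists (delta_mx 0 i).
have [h hP] := choice hex.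
have /finitely_generatedP[m' [g gP]] := Dfg.
apply: (fg_sum (g1 := lincomb h) (g2 := homology_map coker_proj n.+1 \o g)) => v.
have [kv vkv] := connecting_ex v.
have /kP[x kvx] : homology_map f n kv = 0 by apply/connecting_ker; exists v.
have xh : connecting (lincomb h x) kv.
  rewrite kvx [x in k x]matrix_sum_delta big_ord1 linear_sum.
  under eq_bigr do rewrite linearZ.
  exact: connecting_sum.
have [y yE] : exists y, v - lincomb h x = homology_map coker_proj n.+1 y.
  apply: connecting_eq0; have := connecting_linear (-1) xh vkv.
  by rewrite !scaleN1r addNr addrC.
have [y' y'E] := gP y; exists x, y'.
transitivity (lincomb h x + homology_map coker_proj n.+1 y); last by rewrite y'E.
by rewrite -yE addrC subrK.
Qed.

(** A torsion class has torsion connecting image, which vanishes, so the class comes from the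
    homology of [D]; there being torsion in the quotient is exactly failure of saturation. *)
Lemma relative_free n : finitely_generated (homology D n) ->
  (forall m, n = m.+1 -> [/\ finitely_generated (homology C m),
     torsion_free (homology C m) & torsion_free (homology D m)]) ->
  free_module (homology E n) <-> saturated (homology_map f n).
Proof.
move=> Dfg CDn; have Efg : finitely_generated (homology E n).
  by apply: relative_fg => // m /CDn[].
rewrite fg_freeP //; split=> [Etf a x y a0 ay|fsat].
  apply/coker_proj_ker.
  have [|/eqP|//] := Etf a (homology_map coker_proj n y).
    by rewrite -linearZ; apply/coker_proj_ker; exists x.
  by rewrite (negbTE a0).
move=> a h ah0; have [->|a0] := eqVneq a 0; [by left|right].
have [y hy] : exists y, h = homology_map coker_proj n y.
  case: n Dfg CDn Efg fsat h ah0 => [|n] Dfg CDn Efg fsat h ah0.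
    have [u <-] := hclass_surj h; have [z zu] : exists z, pr _ z = val u.
      by elim/modpiW: (val u) => z; exists z.
    exists (hclass D 0 (Submodule (isT : @cycle_pred int D 0 z))).
    by rewrite homology_mapE; congr (hclass E _ _); apply: val_inj; rewrite -zu.
  have [k hk] := connecting_ex h.
  suff k0 : k = 0 by apply: connecting_eq0; rewrite -k0.
  have [_ Ctf _] := CDn _ erefl.
  have := connecting_linear a hk (connecting0 n); rewrite !addr0 ah0.
  by move=> /connecting_fun0/Ctf[a00|//]; rewrite a00 eqxx in a0.
move: ah0; rewrite hy -linearZ => /coker_proj_ker[x ayx].
by apply/coker_proj_ker; exact: fsat ayx.
Qed.
End LongExactSequence.

(** * Interval decompositions by generators *)

Lemma sum_undup (A : nzRingType) (V : lmodType A) (L : eqType) (s : seq L)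
    (c : L -> A) (v : L -> V) :
  \sum_(l <- s) c l *: v l = \sum_(l <- undup s) (c l *+ count_mem l s) *: v l.
Proof.
rewrite -big_undup_iterop_count; apply: eq_bigr => l _.
exact: scalerMnl.
Qed.

Lemma sum_extend (A : nzRingType) (V : lmodType A) (L : eqType) (s t : seq L)
    (c : L -> A) (v : L -> V) : uniq s -> uniq t -> {subset s <= t} ->
  (forall l, c l != 0 -> l \in s) ->
  \sum_(l <- s) c l *: v l = \sum_(l <- t) c l *: v l.
Proof.
move=> us ut st cs; apply: eq_sum_support => // l cv.
have ls : l \in s by apply: cs; apply: contra_neq cv => ->; rewrite scale0r.
by rewrite ls st.
Qed.

Section BasedFamilies.
Variables (d : Order.disp_t) (I : orderType d) (A : nzRingType) (M : pmodule I A).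

(** An interval decomposition by elements: [e l] generates the summand over [J l], and the
    generators alive at [a] form a basis of [M a]. The third clause also covers [b] outside [J l],
    where the generator dies. *)
Definition based_family (L : choiceType) (J : L -> set I) (e : forall (l : L) a, M a) :=
  [/\ forall l, interval_set (J l),
      forall l a, ~ J l a -> e l a = 0,
      forall l a b (ab : (a <= b)%O), J l a -> Defs.pmap M ab (e l a) = e l b,
      forall a x, exists (s : seq L) (c : L -> A), x = \sum_(l <- s) c l *: e l a
    & forall a (s : seq L) (c : L -> A), uniq s -> (forall l, l \in s -> J l a) ->
        \sum_(l <- s) c l *: e l a = 0 -> forall l, l \in s -> c l = 0].

Section FromBased.
Variables (L : choiceType) (J : L -> set I) (e : forall (l : L) a, M a).
Hypothesis eP : based_family J e.
Let Jitv : forall l, interval_set (J l). Proof. by case: eP. Qed.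
Let e_out : forall l a, ~ J l a -> e l a = 0. Proof. by case: eP. Qed.
Let e_map : forall l a b (ab : (a <= b)%O), J l a -> Defs.pmap M ab (e l a) = e l b.
Proof. by case: eP. Qed.

Lemma based_repr a (x : M a) : exists (s : seq L) (c : L -> A),
  [/\ uniq s, forall l, l \in s -> J l a, forall l, c l != 0 -> l \in s
    & x = \sum_(l <- s) c l *: e l a].
Proof.
case: eP => _ _ _ span _; have [s [c ->]] := span _ x.
(* Repeated labels are merged by multiplicity, and labels not alive at [a] are dropped. *)
pose c' l := if (l \in s) && `[< J l a >] then c l *+ count_mem l s else 0.
exists [seq l <- undup s | `[< J l a >]], c'; split=> [|l|l|].
- by rewrite filter_uniq ?undup_uniq.
- by rewrite mem_filter => /andP[/asboolP].
- by rewrite /c' mem_filter mem_undup andbC; case: (_ && _) => //; rewrite eqxx.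
rewrite sum_undup big_filter [RHS]big_mkcond /= big_seq [RHS]big_seq; apply: eq_bigr => l.
rewrite mem_undup /c' => ->; case: asboolP => //= nJ.
by rewrite e_out ?scaler0.
Qed.

Lemma based_unique a (s s' : seq L) (c c' : L -> A) : uniq s -> uniq s' ->
  (forall l, l \in s -> J l a) -> (forall l, l \in s' -> J l a) ->
  (forall l, c l != 0 -> l \in s) -> (forall l, c' l != 0 -> l \in s') ->
  \sum_(l <- s) c l *: e l a = \sum_(l <- s') c' l *: e l a -> c =1 c'.
Proof.
move=> us us' sJ sJ' cs cs' E; pose t := undup (s ++ s').
have st : {subset s <= t} by move=> l ls; rewrite mem_undup mem_cat ls.
have st' : {subset s' <= t} by move=> l ls; rewrite mem_undup mem_cat ls orbT.
have tJ l : l \in t -> J l a.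
  by rewrite mem_undup mem_cat => /orP[/sJ|/sJ'].
move: E; rewrite (sum_extend _ us _ st) ?undup_uniq // (sum_extend _ us' _ st') ?undup_uniq // => /eqP; rewrite -subr_eq0 -sumrB => /eqP E.
move=> l; have [lt|nlt] := boolP (l \in t).
  case: eP => _ _ _ _ /(_ a t (fun l => c l - c' l) (undup_uniq _) tJ) ind.
  apply/eqP; rewrite -subr_eq0; apply/eqP; apply: ind lt.
  by rewrite -[RHS]E; apply: eq_bigr => k _; rewrite scalerBl.
have -> : c l = 0 by apply: contraNeq nlt => /cs/st.
by apply/esym; apply: contraNeq nlt => /cs'/st'.
Qed.

(** Normalized expansions are unique, so the coefficient at [l] depends linearly on the vector. *)
Lemma based_coord a l : J l a ->
  exists f : {linear M a -> A^o}, forall k, f (e k a) = (k == l)%:R.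
Proof.
move=> Jla.
have rep x : exists c : L -> A, exists s : seq L,
    [/\ uniq s, forall l, l \in s -> J l a, forall l, c l != 0 -> l \in s
      & x = \sum_(l <- s) c l *: e l a].
  by have [s [c sc]] := based_repr x; exists c, s.
have [c cP] := choice rep.
pose f x : A^o := c x l.
have fL : linear f.
  move=> k x y; have [s1 [u1 J1 c1 x1]] := cP x; have [s2 [u2 J2 c2 x2]] := cP y.
  have [s3 [u3 J3 c3 x3]] := cP (k *: x + y).
  pose t := undup (s1 ++ s2).
  have s1t : {subset s1 <= t} by move=> l' ls; rewrite mem_undup mem_cat ls.
  have s2t : {subset s2 <= t} by move=> l' ls; rewrite mem_undup mem_cat ls orbT.
  apply: (based_unique u3 (undup_uniq (s1 ++ s2)) J3 _ c3 _ _
    (c' := fun l => k * c x l + c y l) l) => [l'|l'|].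
  - by rewrite mem_undup mem_cat => /orP[/J1|/J2].
  - move=> cc; have [c10|/c1/s1t//] := eqVneq (c x l') 0.
    by apply/s2t/c2; apply: contra_neq cc => ->; rewrite c10 mulr0 addr0.
  - rewrite -x3 [in LHS]x1 [in LHS]x2 (sum_extend _ u1 _ s1t) ?undup_uniq //.
    rewrite [X in _ + X](sum_extend _ u2 _ s2t) ?undup_uniq //.
    rewrite scaler_sumr -big_split; apply: eq_bigr => l' _.
    by rewrite scalerA scalerDl.
pose f' := HB.pack f (GRing.isLinear.Build A (M a) A^o _ f fL) : {linear M a -> A^o}.
exists f' => k; rewrite /= /f.
have [Jka|nJka] := pselect (J k a); last first.
  have -> : (k == l) = false by apply/eqP => kl; rewrite kl in nJka.
  have [s [us sJ cs s0]] := cP (e k a).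
  have -> // : c (e k a) =1 fun=> 0.
  apply: (based_unique (s' := [::]) us) sJ _ cs _ _ => // [l'|]; first by rewrite eqxx.
  by rewrite big_nil -s0 e_out.
have [s [us sJ cs s0]] := cP (e k a).
rewrite eq_sym; have -> // : c (e k a) =1 fun l => (l == k)%:R.
apply: (based_unique (s' := [:: k]) us) sJ _ cs _ _ => // [l'|l'|].
- by rewrite inE => /eqP->.
- by rewrite inE; apply: contraTT => /negbTE->; rewrite eqxx.
- by rewrite -s0 big_seq1 eqxx scale1r.
Qed.


End FromBased.
End BasedFamilies.

Section IntervalModuleFibre.
Variables (A : nzRingType) (V : lmodType A).

Definition to_fibre (b : bool) (f : {linear V -> A^o}) : {linear V -> itv_obj_of A b} :=
  match b return {linear V -> itv_obj_of A b} with true => f | false => \0 end.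

Definition fibre_gen (b : bool) : itv_obj_of A b :=
  match b return itv_obj_of A b with true => (1 : A) | false => 0 end.

Lemma itv_map_gen (x y : bool) : x -> itv_map_of A x y (fibre_gen x) = fibre_gen y.
Proof. by case: x => //; case: y => //= _; apply/rowP; case. Qed.

Lemma fibre_genZ (b : bool) (v : itv_obj_of A b) : exists c, v = c *: fibre_gen b.
Proof.
case: b v => v /=; first by exists v; rewrite [RHS]mulr1.
by exists 0; rewrite scaler0; apply/rowP; case.
Qed.
End IntervalModuleFibre.

Section Decompositions.
Variables (d : Order.disp_t) (I : orderType d) (A : nzRingType) (M : pmodule I A).
Variables (L : choiceType) (J : L -> set I).

(** The summand [N l] is at each index the cyclic submodule spanned by [e l a], and the coordinate
    functional identifies it with the interval module. *)
Lemma based_decomposition (e : forall (l : L) a, M a) : based_family J e ->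
  exists N : L -> psubmodule M, interval_decomposition N J.
Proof.
move=> eP; have [Jitv e_out e_map span ind] := eP.
pose g l a (c : A^o) : M a := c *: e l a.
have gL l a : linear (g l a) by move=> k x y; rewrite /g scalerDl scalerA.
pose g' l a := HB.pack (g l a) (GRing.isLinear.Build A A^o (M a) _ (g l a) (gL l a))
  : {linear A^o -> M a}.
have gP l a x : x \in imm (g' l a) <-> exists c, x = c *: e l a.
  by split=> [/asboolP[c <-]|[c ->]]; [exists c | apply/asboolP; exists c].
have sub l a b (ab : (a <= b)%O) x :
    x \in imm (g' l a) -> Defs.pmap M ab x \in imm (g' l b).
  move=> /gP[c ->]; apply/gP; rewrite linearZ.
  have [Jla|nJla] := pselect (J l a); first by exists c; rewrite /= e_map.
  by exists 0; rewrite e_out //= linear0 scaler0 scale0r.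
pose N l := PSubmodule (fun a b ab x => @sub l a b ab x).
exists N; split=> [a|l].
  split=> [x|s y us yN y0].
    have [s [c ->]] := span a x; exists s, (fun l => c l *: e l a); split=> // l.
    by apply/gP; exists (c l).
  have cex l : exists c : A, y l = c *: e l a by exact/gP/yN.
  have [c cP] := choice cex.
  have {y0}c0 : \sum_(l <- [seq l <- s | `[< J l a >]]) c l *: e l a = 0.
    rewrite -[RHS]y0 big_filter big_mkcond; apply: eq_bigr => l _.
    by rewrite cP; case: asboolP => // nJ; rewrite e_out ?scaler0.
  move=> l ls; rewrite cP; have [Jl|nJl] := pselect (J l a); last first.
    by rewrite e_out ?scaler0.
  rewrite (ind _ _ _ _ _ c0) ?scale0r ?filter_uniq //.
    by move=> k; rewrite mem_filter => /andP[/asboolP].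
  by rewrite mem_filter ls andbT; apply/asboolP.
exists (Jitv l).
have coordE a : exists f : {linear M a -> A^o}, J l a -> forall c, f (c *: e l a) = c.
  have [Jl|nJ] := pselect (J l a); last by exists \0.
  have [f fP] := based_coord eP Jl; exists f => _ c.
  by rewrite linearZ /= fP eqxx; exact: mulr1.
pose f a := sval (cid (coordE a)).
have fP a : J l a -> forall c, f a (c *: e l a) = c by exact: svalP (cid (coordE a)).
pose F a : {linear submodule (imm (g' l a)) -> A^o} := f a \o val.
have valF a (x : submodule (imm (g' l a))) : val x = F a x *: e l a.
  have /gP[c xc] := valP x; rewrite /F /= xc.
  by have [Jl|nJ] := pselect (J l a); [rewrite fP | rewrite e_out ?scaler0].
(* The boolean is generalized because the type of the fibre is a case distinction on it. *)
have bij a (x : bool) : (x <-> J l a) -> bijective (to_fibre x (F a)).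
  have gmem (c : A) : c *: e l a \in imm (g' l a) by apply/gP; exists c.
  case: x => -[Jl nJ].
    exists (fun c : A => Submodule (gmem c)) => [y|c].
      by apply: val_inj; rewrite /= [RHS]valF.
    by rewrite /= /F /= fP //; exact: Jl.
  exists (fun=> 0) => [y|v]; last by apply/rowP; case.
  by apply: val_inj; rewrite [RHS]valF e_out ?scaler0 // => /nJ.
have nat a b (ab : (a <= b)%O) x (ba bb : bool) : (ba <-> J l a) -> (bb <-> J l b) ->
    to_fibre bb (F b) (@psub_map _ _ _ _ (N l) _ _ ab x) =
    itv_map_of A ba bb (to_fibre ba (F a) x).
  case: ba => -[Ja nJa]; case: bb => -[Jb nJb] //=; rewrite (valF a x : submod_val x = _).
    by rewrite linearZ /= e_map ?fP //; try exact: Ja; exact: Jb.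
  by rewrite e_out ?scaler0 ?linear0 ?linear0 // => /nJa.
exists (fun a => to_fibre `[< J l a >] (F a)); split=> [a|a b ab x].
  by apply: bij; split=> /asboolP.
by apply: nat; split=> /asboolP.
Qed.

(** The generator at an index of [J l] is the preimage of 1 under the isomorphism with the interval
    module. *)
Lemma decomposition_based (N : L -> psubmodule M) : interval_decomposition N J ->
  exists e : forall (l : L) a, M a, based_family J e.
Proof.
move=> [Nsum Nitv].
have iso l : exists phi : forall a, {linear psub (N l) a -> itv_obj A (J l) a},
  (forall a, bijective (phi a)) /\ forall a b (ab : (a <= b)%O) x,
    phi b (Defs.pmap (psub (N l)) ab x) = itv_map A (J l) ab (phi a x).
  by have [Jitv] := Nitv l.
pose phi l := sval (cid (iso l)).
have phi_bij l a : bijective (phi l a) by exact: (svalP (cid (iso l))).1.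
have phi_map l a b ab x : phi l b (@psub_map _ _ _ _ (N l) a b ab x) =
  itv_map A (J l) ab (phi l a x) by exact: (svalP (cid (iso l))).2.
have psiE l a : exists psi, cancel (phi l a) psi /\ cancel psi (phi l a).
  by have [psi ? ?] := phi_bij l a; exists psi.
pose psi l a := sval (cid (psiE l a)).
have phiK l a : cancel (phi l a) (psi l a) by exact: (svalP (cid (psiE l a))).1.
have psiK l a : cancel (psi l a) (phi l a) by exact: (svalP (cid (psiE l a))).2.
pose u l a : psub (N l) a := psi l a (fibre_gen A `[< J l a >]).
pose e l a : M a := val (u l a).
have e_mem l a : e l a \in N l a by exact: valP (u l a).
have Ne l a (x : M a) : x \in N l a -> exists c, x = c *: e l a.
  move=> xN; pose x' : psub (N l) a := Submodule xN.
  have [c xc] := fibre_genZ (phi l a x').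
  exists c; rewrite [LHS](_ : _ = val x') //; suff -> : x' = c *: u l a by rewrite linearZ.
  by apply: (can_inj (phiK l a)); rewrite linearZ /= psiK xc.
have e_inj l a (c : A) : J l a -> c *: e l a = 0 -> c = 0.
  move=> Ja ce; have /(congr1 (phi l a)) : c *: u l a = 0.
    by apply: val_inj; rewrite linearZ.
  rewrite linear0 linearZ /= psiK; move: Ja => /asboolP; rewrite /itv_obj.
  by case: `[< J l a >] => //= _; rewrite [c *: _]mulr1.
exists e; split.
- by move=> l; have [Jitv] := Nitv l.
- move=> l a nJ; rewrite /e (_ : u l a = 0) //.
  apply: (can_inj (phiK l a)); rewrite linear0 psiK.
  by move: (fibre_gen _ _) => v; move: nJ v; rewrite /itv_obj; case: asboolP => //= _ _ v; apply/rowP; case.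
- move=> l a b ab Ja; rewrite /e -[LHS]/(val (psub_map ab (u l a))); congr val.
  apply: (can_inj (phiK l b)); rewrite phi_map !psiK; apply: itv_map_gen.
  exact/asboolP.
- move=> a x; have [/(_ x)[s [y [yN ->]]] _] := Nsum a.
  have cex l : exists c : A, y l = c *: e l a by exact/Ne/yN.
  have [c cP] := choice cex.
  by exists s, c; apply: eq_bigr.
- move=> a s c us sJ c0 l ls; apply: (e_inj l a); first exact: sJ.
  have [_ /(_ s (fun l => c l *: e l a) us)] := Nsum a; apply=> //.
  by move=> k; rewrite rpredZ ?e_mem.
Qed.
End Decompositions.

(** * Saturated integral persistence modules *)

Lemma saturated_regular (V W : lmodType int) (f : {linear V -> W}) :
  fin_free W -> saturated f -> exists g : {linear W -> V}, forall v, f (g (f v)) = f v.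
Proof.
move=> Wfree /coker_torsion_free ctf.
have cfg : finitely_generated (coker f).
  apply: (fg_surj (f := modpi (imm f))); last exact: fin_free_fg.
  by elim/modpiW => w; exists w.
have [n [f0 [g0 [f0K g0K]]]] := torsion_free_fin_free cfg ctf.
have lift i : exists w, modpi (imm f) w = g0 (delta_mx 0 i).
  by elim/modpiW: (g0 _) => w; exists w.
(* The cokernel is free, so its projection splits by [lincomb s \o f0]. What remains of a basis
   vector of [W] lies in the image of [f], and its preimages define [g]. *)
have [s sP] := choice lift.
have sec c : modpi (imm f) (lincomb s (f0 c)) = c.
  rewrite -[RHS]f0K.
  apply: (eq_rowlinear (f := modpi (imm f) \o lincomb s) (g := g0)) => i.
  by rewrite /= lincomb_delta sP.
have [m [fW [gW [fWK gWK]]]] := Wfree.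
have pre i : exists v, gW (delta_mx 0 i) -
    lincomb s (f0 (modpi (imm f) (gW (delta_mx 0 i)))) = f v.
  suff /modpi_eq0/asboolP[v <-] : modpi (imm f) (gW (delta_mx 0 i) -
    lincomb s (f0 (modpi (imm f) (gW (delta_mx 0 i))))) = 0 by exists v.
  by rewrite linearB /= sec subrr.
have [t tP] := choice pre.
exists (lincomb t \o fW) => v.
have E w : f (lincomb t (fW w)) = w - lincomb s (f0 (modpi (imm f) w)).
  rewrite -[w in RHS]fWK.
  pose r : {linear 'rV[int]_m -> W} := (gW \- (lincomb s \o f0 \o modpi (imm f) \o gW)).
  by apply: (eq_rowlinear (f := f \o lincomb t) (g := r)) => i; rewrite /= lincomb_delta -tP.
rewrite /= E [modpi _ _](_ : _ = 0); first by rewrite linear0 linear0 subr0.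
by apply/modpi_eq0/asboolP; exists v.
Qed.

Section IntegerModules.
Variables (d : Order.disp_t) (I : orderType d) (M : pmodule I int).

(** The coordinate at a generator not alive at [a] vanishes on the image, hence on [k y], hence on
    [y]. So [y] is the image of the same combination taken at [a]. *)
Lemma based_saturated (L : choiceType) (J : L -> set I) (e : forall (l : L) a, M a) :
  based_family J e -> forall a b (ab : (a <= b)%O), saturated (Defs.pmap M ab).
Proof.
move=> eP a b ab k x y k0 kyx; have [_ e_out e_map span _] := eP.
have [s [c [us sJ _ yE]]] := based_repr eP y.
have cl l : l \in s -> ~ J l a -> c l = 0.
  move=> ls nJ; have [f fP] := based_coord eP (sJ _ ls).
  have fy : f y = c l.
    rewrite yE linear_sum (bigD1_seq l) //= linearZ /= fP eqxx big1 => [|l' l'l].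
      by rewrite addr0; exact: mulr1.
    by rewrite linearZ /= fP (negbTE l'l); rewrite scaler0.
  have : f (k *: y) = 0.
    rewrite kyx; have [s' [c' ->]] := span _ x; rewrite !linear_sum big1 // => l' _.
    rewrite !linearZ /=; have [Jl'|nJ'] := pselect (J l' a); last first.
      by rewrite e_out // !linear0 ?scaler0.
    rewrite e_map // fP (_ : (l' == l) = false); first by rewrite scaler0.
    by apply/eqP => l'l; rewrite l'l in Jl'.
  rewrite linearZ /= fy => /eqP; rewrite [_ *: _]/(k * c l) mulf_eq0 (negbTE k0).
  by move/eqP.
exists (\sum_(l <- s | `[< J l a >]) c l *: e l a).
rewrite yE linear_sum [RHS]big_mkcond /= big_seq [RHS]big_seq.
apply: eq_bigr => l ls; case: asboolP => [Jl|nJ]; last by rewrite cl // scale0r.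
by rewrite linearZ /= e_map.
Qed.

Lemma saturated_based : (forall a, fin_free (M a)) ->
  (forall a b (ab : (a <= b)%O), saturated (Defs.pmap M ab)) ->
  exists (L : choiceType) (J : L -> set I) (e : forall (l : L) a, M a), based_family J e.
Proof.
move=> Mfree Msat.
pose r a := sval (cid (Mfree a)).
pose f a := sval (cid (svalP (cid (Mfree a)))).
pose g a := sval (cid (svalP (cid (svalP (cid (Mfree a)))))).
have fK a : cancel (f a) (g a).
  exact: (svalP (cid (svalP (cid (svalP (cid (Mfree a))))))).1.
have gK a : cancel (g a) (f a).
  exact: (svalP (cid (svalP (cid (svalP (cid (Mfree a))))))).2.
(* Structure maps in chosen bases, acting on row vectors; pairs not in the order relation receive
   the dummy value 0. *)
pose X a b : 'M[int]_(r a, r b) :=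
  if @boolP (a <= b)%O is AltTrue ab then lin1_mx (f b \o Defs.pmap M ab \o g a) else 0.
have XE a b (ab : (a <= b)%O) x : x *m X a b = f b (Defs.pmap M ab (g a x)).
  rewrite /X; case: {-}_ / boolP => [ab'|/negP//].
  by rewrite mul_rV_lin1 /= (bool_irrelevance ab ab').
have mx_ext m n (Y Z : 'M[int]_(m, n)) : (forall x : 'rV_m, x *m Y = x *m Z) -> Y = Z.
  by move=> YZ; apply/row_matrixP => i; rewrite !rowE.
have Xsys : regular_system X.
  split=> [a b c ab bc|a b ab].
    have ac := le_trans ab bc; apply: mx_ext => x.
    by rewrite mulmxA (XE _ _ ab) (XE _ _ bc) (XE _ _ ac) fK -pmap_comp.
  have [h hP] := saturated_regular (Mfree b) (Msat _ _ ab).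
  exists (lin1_mx (f a \o h \o g b)); apply: mx_ext => x.
  by rewrite !mulmxA !XE mul_rV_lin1 /= !fK hP.
have X1 a : X a a = 1%:M.
  by apply: mx_ext => x; rewrite mulmx1 XE // pmap_id gK.
have [L [J [e [p [J0 eP orth full]]]]] := regular_decomposition Xsys X1.
exists L, J, (fun l a => g a (e l a)); split.
- by move=> l; case: (eP l).
- by move=> l a nJ; case: (eP l) => _ /(_ _ nJ)[-> _] _ _ _; rewrite linear0.
- move=> l a b ab Jl; case: (eP l) => _ _ _ /(_ _ _ ab Jl) <- _.
  by rewrite XE fK.
- move=> a x; have [s [us sJ s1]] := full a.
  exists s, (fun l => (f a x *m p l a) 0 0).
  have fxE : f a x = \sum_(l <- s) (f a x *m p l a) 0 0 *: e l a.
    rewrite -[LHS]mulmx1 s1 mulmx_sumr; apply: eq_bigr => l _.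
    by rewrite mulmxA [_ *m p l a in LHS]mx11_scalar mul_scalar_mx.
  by rewrite -[LHS]fK {1}fxE linear_sum; apply: eq_bigr => l _; rewrite linearZ.
- move=> a s c us sJ c0 l ls.
  have : f a (\sum_(l <- s) c l *: g a (e l a)) *m p l a = 0 by rewrite c0 linear0 mul0mx.
  rewrite linear_sum mulmx_suml (bigD1_seq l) //= big1 => [|k kl]; last first.
    by rewrite linearZ /= gK -scalemxAl orth ?scaler0.
  rewrite linearZ /= gK -scalemxAl addr0.
  case: (eP l) => _ _ /(_ _ (sJ _ ls)) -> _ _ /matrixP/(_ 0 0).
  by rewrite !mxE mulr1.
Qed.
End IntegerModules.

(** * Uniqueness of the persistence diagram *)

Section ConvexSets.
Variables (d : Order.disp_t) (I : orderType d) (a : I).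
Implicit Types (S T : set I) (ts : seq (set I)).

(** For each [T] missing some [z] of [S], one of the two points is moved out to [z]. By convexity
    any interval through [a] containing the new point contains the old one, so earlier separations
    persist. *)
Lemma separating_points S ts : S a -> interval_set S ->
  (forall T, T \in ts -> T a /\ interval_set T) ->
  exists x y, [/\ S x, S y, (x <= a)%O, (a <= y)%O
    & forall T, T \in ts -> T x -> T y -> S `<=` T].
Proof.
move=> Sa Sitv; elim: ts => [|T ts IHts] tsP; first by exists a, a; split.
have [|x [y [Sx Sy xa ay xyP]]] := IHts; first by move=> T' T'ts; apply: tsP; rewrite inE T'ts orbT.
have [Ta Titv] := tsP T (mem_head _ _).
have [ST|/existsNP[z /not_implyP[Sz nTz]]] := pselect (S `<=` T).
  by exists x, y; split=> // T'; rewrite inE => /orP[/eqP->|/xyP].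
have [za|az] := leP z a.
  exists (Order.min x z), y; split=> //; first by case: leP.
    by rewrite ge_min xa.
  move=> T'; rewrite inE => /orP[/eqP-> Tm _|T'ts Tm Ty].
    by case: nTz; apply: (Titv _ _ _ Tm Ta) => //; rewrite ge_min lexx orbT.
  have [T'a T'itv] := tsP T' (@mem_behead _ (T :: ts) _ T'ts).
  apply: xyP => //; apply: (T'itv _ _ _ Tm T'a) => //.
  by rewrite ge_min lexx.
exists x, (Order.max y z); split=> //; first by case: leP.
  by rewrite le_max ay.
move=> T'; rewrite inE => /orP[/eqP-> _ Tm|T'ts Tx Tm].
  by case: nTz; apply: (Titv _ _ _ Ta Tm); [exact: ltW | rewrite le_max lexx orbT].
have [T'a T'itv] := tsP T' (@mem_behead _ (T :: ts) _ T'ts).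
apply: xyP => //; apply: (T'itv _ _ _ T'a Tm) => //.
by rewrite le_max lexx.
Qed.

Lemma maximal_member ts : ts != [::] ->
  exists S, S \in ts /\ forall T, T \in ts -> S `<=` T -> T = S.
Proof.
elim: ts => [//|T0 ts IHts] _; case: (eqVneq ts [::]) => [->|/IHts[S [Sts Smax]]].
  by exists T0; split=> [|T]; rewrite mem_seq1 // => /eqP.
have [ST|nST] := pselect (S `<=` T0).
  exists T0; split=> [|T]; first exact: mem_head.
  rewrite inE => /orP[/eqP//|Tts] T0T.
  rewrite (Smax T Tts); last exact: subset_trans ST T0T.
  by apply/seteqP; split=> //; rewrite -(Smax T Tts) //; exact: subset_trans ST T0T.
exists S; split=> [|T]; first by rewrite inE Sts orbT.
by rewrite inE => /orP[/eqP->|]; [|exact: Smax].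
Qed.

(* Intervals through [a] are distinguished by counting those that contain two
   given points: a maximal one is the only one containing suitable points. *)
Lemma perm_eq_intervals ts ts' :
  (forall T, T \in ts -> T a /\ interval_set T) ->
  (forall T, T \in ts' -> T a /\ interval_set T) ->
  (forall x y, (x <= a)%O -> (a <= y)%O ->
     count (fun T => `[< T x /\ T y >]) ts = count (fun T => `[< T x /\ T y >]) ts') ->
  perm_eq ts ts'.
Proof.
move: {2}(size ts) (erefl (size ts)) => n; elim: n ts ts' => [|n IHn] ts ts' sz tsP ts'P xyP.
  move/eqP: sz; rewrite size_eq0 => /eqP ts0; subst ts.
  have := xyP a a (lexx a) (lexx a); rewrite /= => /esym/eqP.
  rewrite eqn0Ngt -has_count => /hasPn h; suff -> : ts' = [::] by [].
  case: ts' ts'P h {xyP} => // T ts' /(_ T (mem_head _ _))[Ta _] /(_ T (mem_head _ _)).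
  by rewrite asboolT.
have [|S [Sts Smax]] := @maximal_member (ts ++ ts').
  by case: (ts) sz.
have uP T : T \in ts ++ ts' -> T a /\ interval_set T.
  by rewrite mem_cat => /orP[/tsP|/ts'P].
have [Sa Sitv] := uP _ Sts.
have [x [y [Sx Sy xa ay sep]]] := separating_points Sa Sitv uP.
(* A member containing both [x] and [y] contains [S], and so equals it by maximality; the count
   therefore gives the multiplicity of [S]. *)
have cS us : {subset us <= ts ++ ts'} ->
    count (fun T => `[< T x /\ T y >]) us = count_mem S us.
  move=> usP; apply: eq_in_count => T /usP Tts /=.
  apply/asboolP/eqP => [[Tx Ty]|-> //]; first by apply: Smax => //; exact: sep.
have cE : count_mem S ts = count_mem S ts'.
  rewrite -!cS ?xyP // => T Tts; rewrite mem_cat Tts ?orbT //.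
have Sts1 : S \in ts.
  move: Sts; rewrite mem_cat => /orP[//|].
  by rewrite -has_pred1 has_count -cE -has_count has_pred1.
have Sts2 : S \in ts' by rewrite -has_pred1 has_count -cE -has_count has_pred1.
have p1 := perm_to_rem Sts1; have p2 := perm_to_rem Sts2.
apply: (perm_trans p1); rewrite perm_sym; apply: (perm_trans p2); rewrite perm_cons perm_sym.
apply: IHn => [|T /mem_rem/tsP//|T /mem_rem/ts'P//|x' y' x'a ay'].
  by rewrite size_rem // sz.
have := xyP x' y' x'a ay'.
by rewrite (permP p1) (permP p2) /= => /eqP; rewrite eqn_add2l => /eqP.
Qed.
End ConvexSets.

Section Dimension.
Variables (F : fieldType) (V : lmodType F) (m q : nat).
Variables (v : 'I_m -> V) (w : 'I_q -> V).
Hypotheses (v_ind : forall x, lincomb v x = 0 -> x = 0)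
  (v_span : forall i, exists y, v i = lincomb w y).

(** The matrix expressing [v] through [w] has independent rows; its rank gives both the inequality
    and the equality case. *)
Let coefs : exists P : 'M[F]_(m, q), row_free P /\ forall x, lincomb v x = lincomb w (x *m P).
Proof.
have [y yP] := choice v_span; pose P : 'M[F]_(m, q) := \matrix_i y i; exists P.
have PE x : lincomb v x = lincomb w (x *m P).
  apply: (eq_rowlinear (f := lincomb v) (g := lincomb w \o mulmxr P)) => i.
  by rewrite /= lincomb_delta yP -rowE rowK.
split=> //; rewrite -kermx_eq0; apply/eqP/row_matrixP => i; rewrite row0.
by apply: v_ind; rewrite PE -row_mul mulmx_ker row0 linear0.
Qed.

Lemma independent_leq_spanning : (m <= q)%N.
Proof. by have [P [/eqP Pm _]] := coefs; rewrite -{1}Pm; exact: rank_leq_col. Qed.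

Lemma spanning_independent : m = q -> forall x, lincomb w x = 0 -> x = 0.
Proof.
have [P [Pfree PE]] := coefs => mq x w0.
have Pfull : row_full P by move: Pfree; rewrite /row_free /row_full => /eqP->; rewrite mq.
have /submxP[y xy] : (x <= P)%MS by exact: submx_full.
by rewrite xy -PE in w0; rewrite xy (v_ind w0) mul0mx.
Qed.
End Dimension.

Lemma card_uniq_seq (L : choiceType) (s : seq L) (D : set L) : uniq s ->
  (forall l, l \in s <-> D l) -> (D #= `I_(size s))%card.
Proof.
case: s => [|l0 s] us sD.
  have -> : D = set0 by rewrite -subset0 => l /sD.
  by rewrite II0 card_eq00.
have -> : D = nth l0 (l0 :: s) @` `I_(size (l0 :: s)).
  apply/seteqP; split=> [l /sD ls|_ [i /= si <-]]; last exact/sD/mem_nth.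
  by exists (index l (l0 :: s)); [rewrite /mkset index_mem | exact: nth_index].
apply: inj_card_eq => i j; rewrite !inE => si sj /eqP.
by rewrite nth_uniq // => /eqP.
Qed.

Lemma seq_lincomb (A : nzRingType) (V : lmodType A) (L : eqType) (s : seq L)
    (c : L -> A) (v : L -> V) :
  \sum_(l <- s) c l *: v l =
  lincomb (fun i => v (tnth (in_tuple s) i)) (\row_i c (tnth (in_tuple s) i)).
Proof. by rewrite big_tnth /= /lincomb; apply: eq_bigr => i _; rewrite mxE. Qed.

Section Uniqueness.
Variables (d : Order.disp_t) (I : orderType d) (F : fieldType) (M : pmodule I F).

Lemma based_independent (L : choiceType) (J : L -> set I) (e : forall (l : L) a, M a)
    a (s : seq L) : based_family J e -> uniq s -> (forall l, l \in s -> J l a) ->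
  forall x, lincomb (fun i => e (tnth (in_tuple s) i) a) x = 0 -> x = 0.
Proof.
move=> [_ _ _ _ ind] us sJ x x0.
pose c l := \sum_i (if tnth (in_tuple s) i == l then x 0 i else 0).
have cE j : c (tnth (in_tuple s) j) = x 0 j.
  rewrite /c (bigD1 j) //= eqxx big1 ?addr0 // => i ij.
  by rewrite (inj_eq (tuple_uniqP (in_tuple s) us)) (negbTE ij).
have xE : x = \row_i c (tnth (in_tuple s) i) by apply/rowP => i; rewrite mxE cE.
move: x0; rewrite xE -(seq_lincomb s c (fun l => e l a)) => /(ind a s c us sJ) c0.
by apply/rowP => i; rewrite !mxE c0 // mem_tnth.
Qed.

Lemma based_bounded (L : choiceType) (J : L -> set I) (e : forall (l : L) a, M a) a :
  based_family J e -> finitely_generated (M a) ->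
  exists s : seq L, uniq s /\ forall l, l \in s <-> J l a.
Proof.
move=> eP /finitely_generatedP[n [g gM]]; apply: (@enum_bounded _ _ n) => s us sJ.
apply: (independent_leq_spanning (based_independent eP us sJ)
  (w := fun i => g (delta_mx 0 i))) => i.
have [x ->] := gM (e (tnth (in_tuple s) i) a); exists x.
by apply: (eq_rowlinear (g := lincomb (fun i => g (delta_mx 0 i)))) => j; rewrite /= lincomb_delta.
Qed.

(** Generators alive at [a] but not at [b] die on the way, so those alive at both span the image. *)
Lemma based_image (L : choiceType) (J : L -> set I) (e : forall (l : L) a, M a)
    a b (ab : (a <= b)%O) (s : seq L) x : based_family J e -> uniq s ->
  (forall l, l \in s <-> J l a /\ J l b) ->
  exists y, Defs.pmap M ab x = lincomb (fun i => e (tnth (in_tuple s) i) b) y.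
Proof.
move=> eP us sJ; have [_ e_out e_map _ _] := eP.
have [t [c [ut tJ ct ->]]] := based_repr eP x.
rewrite linear_sum (eq_sum_support (s2 := s)) // => [|l].
  rewrite big_seq; under eq_bigr => l /sJ[Ja _] do rewrite linearZ /= e_map //.
  by rewrite -big_seq (seq_lincomb s c (fun l => e l b)); eexists; reflexivity.
rewrite linearZ /= => ce0.
have lt : l \in t by apply: ct; apply: contra_neq ce0 => ->; rewrite scale0r.
rewrite lt; apply/esym/sJ; split; first exact: tJ.
apply: contrapT => nJ; move: ce0.
by rewrite (e_map _ _ _ ab (tJ l lt)) (e_out l b nJ) scaler0 eqxx.
Qed.

Section TwoFamilies.
Variables (L L' : choiceType) (J : L -> set I) (J' : L' -> set I)
  (e : forall (l : L) a, M a) (e' : forall (l : L') a, M a).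
Hypotheses (eP : based_family J e) (eP' : based_family J' e').

(** Generators alive at both ends are independent in the image of the map, and the other family's
    generators alive at both ends span that image. *)
Lemma based_size_leq a b (ab : (a <= b)%O) (s : seq L) (s' : seq L') : uniq s -> uniq s' ->
  (forall l, l \in s <-> J l a /\ J l b) -> (forall l, l \in s' <-> J' l a /\ J' l b) ->
  (size s <= size s')%N.
Proof.
move=> us us' sJ sJ'; have [_ _ e_map _ _] := eP.
have sJb l : l \in s -> J l b by case/sJ.
apply: (independent_leq_spanning (based_independent eP us sJb)
  (w := fun i => e' (tnth (in_tuple s') i) b)) => i.
have [Ja Jb] : J (tnth (in_tuple s) i) a /\ J (tnth (in_tuple s) i) b.
  by apply/sJ/mem_tnth.
by rewrite -(e_map _ _ _ ab Ja); exact: (based_image ab _ eP' us' sJ').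
Qed.
End TwoFamilies.

Lemma based_perm_eq (L L' : choiceType) (J : L -> set I) (J' : L' -> set I)
    (e : forall (l : L) a, M a) (e' : forall (l : L') a, M a) a (s : seq L) (s' : seq L') :
  based_family J e -> based_family J' e' -> uniq s -> uniq s' ->
  (forall l, l \in s <-> J l a) -> (forall l, l \in s' <-> J' l a) ->
  perm_eq [seq J l | l <- s] [seq J' l | l <- s'].
Proof.
move=> eP eP' us us' sJ sJ'; have [Jitv _ _ _ _] := eP; have [Jitv' _ _ _ _] := eP'.
apply: (@perm_eq_intervals _ _ a) => [_ /mapP[l /sJ Ja ->] // | _ /mapP[l /sJ' Ja ->] //|].
move=> x y xa ay; rewrite !count_map -!size_filter; set sx := seq.filter _ s; set sx' := seq.filter _ s'.
have sxJ l : l \in sx <-> J l x /\ J l y.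
  rewrite mem_filter /=; split=> [/andP[/asboolP]//|[Jx Jy]]; apply/andP; split; first exact/asboolP.
  by apply/sJ; exact: Jitv Jx Jy xa ay.
have sxJ' l : l \in sx' <-> J' l x /\ J' l y.
  rewrite mem_filter /=; split=> [/andP[/asboolP]//|[Jx Jy]]; apply/andP; split; first exact/asboolP.
  by apply/sJ'; exact: Jitv' Jx Jy xa ay.
have xy := le_trans xa ay.
by apply/eqP; rewrite eqn_leq (based_size_leq eP eP' xy) ?(based_size_leq eP' eP xy) ?filter_uniq.
Qed.
End Uniqueness.

Lemma card_fibre (T : Type) (L : choiceType) (J : L -> set T) a (s : seq L) (S : set T) :
  uniq s -> (forall l, l \in s <-> J l a) -> S a ->
  ([set l | J l = S] #= `I_(count_mem S [seq J l | l <- s]))%card.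
Proof.
move=> us sJ Sa; rewrite count_map -size_filter.
apply: card_uniq_seq => [|l]; first by rewrite filter_uniq.
rewrite mem_filter; split=> [/andP[/eqP]//|JS].
by rewrite /= JS eqxx; apply/sJ; rewrite JS.
Qed.

(** * Change of coefficients in a filtration *)

(** A left inverse sends [f \o s] to [s] and every simplex not of this form to 0. *)
Lemma singular_map_inj (R : realType) (A : nzRingType) (X Y : topologicalType)
    (f : continuousType X Y) : injective f ->
  forall n (x : singular R A X n), singular_map R A f n x = 0 -> x = 0.
Proof.
move=> f_inj n x x0.
pose g (t : sing R Y n) : singular R A X n :=
  if pselect (exists s : sing R X n, (f \o s : sing R Y n) = t) is left st
  then << sval (cid st) >> else 0.
have gK : fglift g \o singular_map R A f n =1 idfun.
  apply: (eq_freeg (f := fglift g \o singular_map R A f n) (g := idfun)) => s /=.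
  rewrite sing_mapU liftU scale1r /g; case: pselect => [st|[]]; last by exists s.
  congr << _ >>; have /continuousEP E := svalP (cid st).
  by apply/continuousEP => y; apply: f_inj; exact: E.
by rewrite -[LHS](gK x) /= x0 linear0.
Qed.

Section ChangeOfCoefficients.
Variables (R : realType) (F : fieldType).

Lemma coef_homology_map (X Y : topologicalType) (f : continuousType X Y) n
    (h : sing_homology R int X n) :
  sing_homology_map R F f n (coef_homology R F X n h : sing_homology R F X n) =
  (coef_homology R F Y n (sing_homology_map R int f n h) : sing_homology R F Y n).
Proof.
have [z <-] := hclass_surj h.
rewrite coef_homologyE (homology_mapE (singular_map R F f)).
rewrite (homology_mapE (singular_map R int f)) coef_homologyE.
congr (hclass _ _ _); apply: val_inj => /=.
set c : {freeg (sing R X n) / int} := submod_val z.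
have mapE (A : nzRingType) (a : sing R X n -> A) :
    singular_map R A f n (\sum_(s <- dom c) a s *: << s >>) =
    \sum_(s <- dom c) a s *: << (f \o s : sing R Y n) >> :> singular R A Y n.
  by rewrite linear_sum; apply: eq_bigr => s _; rewrite linearZ /= sing_mapU.
have coefE (Z : topologicalType) (u : sing R X n -> sing R Z n) :
    (coef_chain R F Z n (\sum_(s <- dom c) coeff s c *: << u s >>) : singular R F Z n) =
    \sum_(s <- dom c) (coeff s c)%:~R *: << u s >>.
  by rewrite coef_chain_sum; apply: eq_bigr => s _; rewrite coef_chainU.
rewrite (freeg_sum_coeff c : c = _ :> singular R int X n) (coefE X id) mapE.
rewrite (mapE int (fun s => coeff s c)); exact/esym/(coefE Y (fun s => f \o s)).
Qed.

Variables (X : topologicalType) (n : nat).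
Local Notation HZ := (sing_homology R int X n).
Local Notation HF := (sing_homology R F X n).
Local Notation coef := (coef_homology R F X n).

Lemma coefZ (a : int) (h : HZ) : (coef (a *: h) : HF) = a%:~R *: (coef h : HF).
Proof. by rewrite linearZ /= scalezrE scaler_int. Qed.

Lemma coef_sum (T : Type) (s : seq T) (a : T -> int) (h : T -> HZ) :
  (coef (\sum_(i <- s) a i *: h i) : HF) = \sum_(i <- s) (a i)%:~R *: (coef (h i) : HF).
Proof. by rewrite linear_sum; apply: eq_bigr => i _; rewrite -coefZ. Qed.

Hypothesis Htf : forall m, n = m.+1 -> torsion_free (sing_homology R int X m).

Lemma uct_bij : bijective (uct R F X n).
Proof.
have [g gK] := choice (uct_surj (F := F) Htf).
apply: (Bijective _ gK) => t.
by apply/eqP; rewrite -subr_eq0; apply/eqP/uct_inj;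
  rewrite linearB; apply/eqP; rewrite subr_eq0; apply/eqP; exact: gK.
Qed.

Lemma coef_span (h : HF) : exists (s : seq (HZ * F)), h = \sum_(q <- s) q.2 *: (coef q.1 : HF).
Proof.
have [t <-] := uct_surj Htf h; have [s ->] := tensorW t; exists s.
exact: uctE.
Qed.

(** The functional is extended to the tensor product and transported along the inverse of the
    universal coefficient isomorphism. *)
Lemma coef_functional (f : {linear HZ -> int^o}) :
  exists g : {linear HF -> F^o}, forall h, g (coef h) = (f h)%:~R.
Proof.
have phiB : balanced (fun (h : HZ) (x : F) => ((f h)%:~R * x : F^o)).
  split=> [h h' x|h x x'|h a x]; first by rewrite linearD intrD mulrDl.
    by rewrite mulrDr.
  by rewrite mulrCA.
have [u uK Ku] := uct_bij.
have uL := can_linear uK Ku.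
pose u' := HB.pack u (GRing.isLinear.Build F HF _ _ u uL) : {linear HF -> tensor HZ F}.
exists (tensor_lift phiB \o u') => h.
have -> : (coef h : HF) = uct R F X n (tens h 1).
  by rewrite [RHS]tensor_liftE scale1r.
rewrite -[LHS]/(tensor_lift phiB (u (uct R F X n (tens h 1)))) uK.
by rewrite [LHS]tensor_liftE mulr1.
Qed.

Lemma coef_fg : finitely_generated HZ -> finitely_generated HF.
Proof.
move=> /finitely_generatedP[m [g gH]]; apply/finitely_generatedP.
exists m, (lincomb (fun i => coef (g (delta_mx 0 i)) : HF)) => h.
have [s ->] := coef_span h; elim: s => [|[k c] s [x IHs]].
  by exists 0; rewrite big_nil linear0.
have [y ->] := gH k; exists (c *: map_mx intr y + x).
rewrite big_cons IHs linearP /=; congr (_ *: _ + _).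
have -> : g y = \sum_i y 0 i *: g (delta_mx 0 i).
  rewrite [y in LHS]matrix_sum_delta big_ord1 linear_sum.
  by apply: eq_bigr => i _; rewrite linearZ.
apply: etrans (coef_sum _ _ _) _.
by apply: eq_bigr => i _; rewrite mxE.
Qed.
End ChangeOfCoefficients.

Definition in_span (A : nzRingType) (V : lmodType A) (L : eqType) (v : L -> V) (x : V) :=
  exists (s : seq L) (c : L -> A),
    [/\ uniq s, forall l, c l != 0 -> l \in s & x = \sum_(l <- s) c l *: v l].

Lemma in_span_linear (A : nzRingType) (V : lmodType A) (L : eqType) (v : L -> V) a x y :
  in_span v x -> in_span v y -> in_span v (a *: x + y).
Proof.
move=> [s [c [us cs ->]]] [s' [c' [us' cs' ->]]].
pose t := undup (s ++ s').
have st : {subset s <= t} by move=> l ls; rewrite mem_undup mem_cat ls.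
have st' : {subset s' <= t} by move=> l ls; rewrite mem_undup mem_cat ls orbT.
exists t, (fun l => a * c l + c' l); split=> [|l ca|]; first exact: undup_uniq.
  have [c0|/cs/st//] := eqVneq (c l) 0; apply/st'/cs'.
  by apply: contra_neq ca => ->; rewrite c0 mulr0 addr0.
rewrite (sum_extend _ us (undup_uniq _) st) // (sum_extend _ us' (undup_uniq _) st') //.
rewrite scaler_sumr -big_split; apply: eq_bigr => l _.
by rewrite scalerA scalerDl.
Qed.

Section Filtration.
Variables (R : realType) (d : Order.disp_t) (I : orderType d) (K : filtration I) (n : nat).
Local Notation HM A := (filtration_homology R K n A).
Hypothesis Htf : forall a m, n = m.+1 -> torsion_free (sing_homology R int (K a) m).

Section Extension.
Variables (F : fieldType) (L : choiceType) (J : L -> set I).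
Variable e : forall (l : L) a, HM int a.
Local Notation coef a := (coef_homology R F (K a) n).

(** The reduced generators span by surjectivity of the universal coefficient map; the integral
    coordinate functionals, carried over to [F], show that they are independent. *)
Lemma based_extend : based_family J e ->
  based_family (M := HM F) J (fun l a => coef a (e l a)).
Proof.
move=> eP; have [Jitv e_out e_map _ _] := eP; split=> //.
- by move=> l a nJ; rewrite e_out // [LHS]linear0.
- move=> l a b ab Jl; rewrite -(e_map _ _ _ ab Jl).
  exact: coef_homology_map.
- move=> a x; suff [s [c [_ _ ->]]] : in_span (fun l => coef a (e l a) : HM F a) x.
    by exists s, c.
  have [s ->] := coef_span (@Htf a) x; elim: s => [|[h c] s IHs].
    by rewrite big_nil; exists [::], (fun=> 0); split; rewrite ?big_nil // => l; rewrite eqxx.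
  rewrite big_cons; apply: in_span_linear => {IHs}//=.
  have [t [k [ut _ kt ->]]] := based_repr eP h.
  exists t, (fun l => (k l)%:~R); split=> // [l kl|]; last exact: coef_sum.
  by apply: kt; apply: contra_neq kl => ->.
- move=> a s c us sJ c0 l ls.
  have [f fP] := based_coord eP (sJ _ ls).
  have [g gP] := coef_functional F (@Htf a) f.
  have := congr1 g c0; rewrite linear0 linear_sum (bigD1_seq l) //= big1 => [|k kl].
    by rewrite linearZ /= gP fP eqxx addr0 => /esym; rewrite [_ *: _]mulr1 => ->.
  by rewrite linearZ /= gP fP (negbTE kl) [_ *: _]mulr0.
Qed.
End Extension.

Lemma based_persistence_diagram (L : choiceType) (J : L -> set I)
    (e : forall (l : L) a, HM int a) :
  (forall a, finitely_generated (HM int a)) -> based_family J e ->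
  exists D : set I -> nat, forall F : fieldType, persistence_diagram (HM F) D.
Proof.
move=> Hfg eP.
(* The multiplicities depend on [J] alone, hence not on the field. The nonemptiness condition makes
   the default 0 the value at the empty set. *)
pose D S := xget 0%N [set k | S !=set0 /\ ([set l | J l = S] #= `I_k)%card].
have Ffg (F : fieldType) a : finitely_generated (HM F a) by exact: coef_fg (@Htf a) (Hfg a).
have DP S : S !=set0 -> ([set l | J l = S] #= `I_(D S))%card.
  move=> S0; have [a Sa] := S0.
  (* Dimension over the rationals bounds the number of generators alive at [a]. *)
  have [s [us sJ]] := based_bounded (based_extend rat eP) (Ffg rat a).
  have : [set k | S !=set0 /\ ([set l | J l = S] #= `I_k)%card]
      (count_mem S [seq J l | l <- s]) by split=> //; exact: card_fibre us sJ Sa.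
  by move=> /(xgetI 0%N)[].
exists D => F D'; have FP := based_extend F eP.
split=> [[L' [N' [J' [N'J' [D'0 D'P]]]]]|->]; last first.
  have [N NJ] := based_decomposition FP; exists L, N, J; split=> //; split=> //.
  by rewrite /D xgetPN // => k [[x]].
have [e' eP'] := decomposition_based N'J'.
apply/funext => S; have [->|/set0P S0] := eqVneq S set0.
  by rewrite D'0 /D xgetPN // => k [[x]].
have [a Sa] := S0.
have [s [us sJ]] := based_bounded FP (Ffg F a).
have [s' [us' sJ']] := based_bounded eP' (Ffg F a).
have cE (k k' : nat) (B : choiceType) (T : set B) :
    (T #= `I_k)%card -> (T #= `I_k')%card -> k = k'.
  by move=> Tk Tk'; apply/card_eq_II; rewrite -(card_eql Tk).
have Dc := cE _ _ _ _ (DP _ S0) (card_fibre us sJ Sa).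
rewrite Dc (cE _ _ _ _ (D'P _ S0) (card_fibre us' sJ' Sa)).
by have /permP -> := based_perm_eq FP eP' us us' sJ sJ'.
Qed.
End Filtration.

(** * From equal diagrams over all fields to saturated maps *)

Lemma clear_denominators q (c : 'rV[rat]_q) :
  exists (N : int) (z : 'rV[int]_q), N != 0 /\ N%:~R *: c = map_mx intr z.
Proof.
pose N := \prod_i denq (c 0 i).
have zP i : exists z : int, N%:~R * c 0 i = z%:~R.
  exists (numq (c 0 i) * \prod_(j | j != i) denq (c 0 j)).
  by rewrite /N (bigD1 i) //= !intrM numqE mulrC mulrA.
have [z zE] := choice zP.
exists N, (\row_i z i); split; last by apply/rowP => i; rewrite !mxE zE.
by apply/prodf_neq0 => i _; rewrite denq_eq0.
Qed.

(** A positive multiplier is stripped of its prime factors one at a time; a sign is absorbed in the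
    preimage. *)
Lemma saturated_prime (V W : lmodType int) (f : {linear V -> W}) :
  (forall (p : nat) v w, prime p -> (p%:Z) *: w = f v -> exists v', w = f v') -> saturated f.
Proof.
move=> fp a v w a0 aw.
wlog [k k0 {a a0 aw} aw] : / exists2 k : nat, (0 < k)%N & exists v', k%:Z *: w = f v'.
  apply; exists `|a|%N; first by rewrite absz_gt0.
  by case: (intP a) aw => [|m|m] aw; [exists v|exists v|exists (- v); rewrite linearN -aw scaleNr opprK].
elim/ltn_ind: k k0 w aw {v} => k IHk k0 w [v kw].
have [k1|k1] := leqP k 1.
  by exists v; rewrite -kw (_ : k = 1%N) ?scale1r //; apply/eqP; rewrite eqn_leq k1.
have pp := pdiv_prime k1; have [m kE] := dvdnP (pdiv_dvd k).
have m0 : (0 < m)%N by case: (m) kE k0 => [->|].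
apply: (IHk m) => //; first by rewrite kE ltn_Pmulr // prime_gt1.
have [v' v'E] : exists v', m%:Z *: w = f v'.
  apply: (fp _ v _ pp).
  by rewrite scalerA -PoszM mulnC -kE.
by exists v'.
Qed.

Section Filtration.
Variables (R : realType) (d : Order.disp_t) (I : orderType d) (K : filtration I) (n : nat).
Local Notation HM A := (filtration_homology R K n A).
Hypothesis Htf : forall a m, n = m.+1 -> torsion_free (sing_homology R int (K a) m).
Hypothesis Hfree : forall a, fin_free (HM int a).

(** Each integral coordinate extends to a rational functional, which detects it. *)
Lemma coef_rat_inj a (h : HM int a) : (coef_homology R rat (K a) n h : HM rat a) = 0 -> h = 0.
Proof.
move=> h0; have [m [f [g [fK gK]]]] := Hfree a.
suff f0 : f h = 0 by rewrite -(fK h) f0 linear0.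
apply/rowP => j; rewrite [RHS]mxE.
pose l x : int^o := f x 0 j.
have lL : linear l by move=> k x y; rewrite /l linearP !mxE.
pose l' := HB.pack l (GRing.isLinear.Build int (HM int a) int^o _ l lL) : {linear HM int a -> int^o}.
have [l1 l1E] := coef_functional rat (@Htf a) l'.
have := l1E h; rewrite h0 linear0 => /esym/eqP.
by rewrite intr_eq0 => /eqP.
Qed.

Variable D : set I -> nat.
Hypothesis DP : forall F : fieldType, persistence_diagram (HM F) D.

(** The generators alive at [a] and [b] form a basis of the image, and the diagram determines their
    number; hence one [r] serves all fields. *)
Lemma diagram_image_basis a b (ab : (a <= b)%O) : exists r : nat, forall F : fieldType,
  exists v : 'I_r -> HM F b,
  [/\ forall x, lincomb v x = 0 -> x = 0, forall i, exists u, v i = Defs.pmap (HM F) ab u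
    & forall u, exists x, Defs.pmap (HM F) ab u = lincomb v x].
Proof.
(* [js] lists the intervals through [a] with multiplicity. [D] determines it up to permutation, so
   the list found over the rationals fixes [r]. *)
pose Q (F : fieldType) (js : seq (set I)) :=
  (forall S, count_mem S js = if `[< S a >] then D S else 0%N) /\
  exists v : 'I_(count (fun S : set I => `[< S b >]) js) -> HM F b,
  [/\ forall x, lincomb v x = 0 -> x = 0, forall i, exists u, v i = Defs.pmap (HM F) ab u
    & forall u, exists x, Defs.pmap (HM F) ab u = lincomb v x].
have QF F : exists js, Q F js.
  have [L [N [J [NJ [D0 DJ]]]]] := (DP F D).2 erefl.
  have [e eP] := decomposition_based NJ.
  have Ffg : finitely_generated (HM F a) by apply: coef_fg (@Htf a) (fin_free_fg (Hfree a)).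
  have [s [us sJ]] := based_bounded eP Ffg.
  exists [seq J l | l <- s]; split.
    move=> S; case: asboolP => [Sa|nSa].
      apply/card_eq_II; rewrite -(card_eql (card_fibre us sJ Sa)); apply: DJ.
      by exists a.
    by apply/count_memPn/mapP => -[l /sJ Ja SJ]; apply: nSa; rewrite SJ.
  rewrite count_map -size_filter; set t := seq.filter _ s.
  have tJ l : l \in t <-> J l a /\ J l b.
    rewrite mem_filter; split=> [/andP[/asboolP Jb /sJ//]|[/sJ -> Jb]].
    by rewrite andbT; apply/asboolP.
  have ut : uniq t by rewrite filter_uniq.
  have tJb l : l \in t -> J l b by case/tJ.
  exists (fun i => e (tnth (in_tuple t) i) b); split.
  - exact: based_independent eP ut tJb.
  - move=> i; exists (e (tnth (in_tuple t) i) a).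
    have [_ _ e_map _ _] := eP; rewrite e_map //.
    by have [] := (tJ (tnth (in_tuple t) i)).1 (mem_tnth _ _).
  - by move=> u; exact: based_image eP ut tJ.
have [js0 [js0D _]] := QF rat.
exists (count (fun S : set I => `[< S b >]) js0) => F.
have [js [jsD +]] := QF F.
suff /permP -> : perm_eq js js0 by [].
by apply/allP => S _ /=; rewrite jsD js0D.
Qed.

(** A basis of the integral image has independent reductions over the rationals, so its size is the
    common rank. Modulo [p] its reductions span an image of that same rank, so they are independent
    there as well, which excludes [p]-torsion in the cokernel. *)
Lemma diagram_saturated a b (ab : (a <= b)%O) :
  saturated (sing_homology_map R int (incl_map K ab) n).
Proof.
set f := sing_homology_map R int (incl_map K ab) n.
apply: saturated_prime => p x y pp pyx.
have [r rP] := diagram_image_basis ab.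
have Mtf c := fin_free_torsion_free (Hfree c).
have /finitely_generatedP[m [g gM]] := fin_free_fg (Hfree a).
(* [h] is a basis of the image of [f]; [P] and [Q] translate between its coordinates and the
   generators [g] of the source. *)
have [i j ->|q [h [P [Q [gP hQ h0]]]]] :=
  @reduce_generators _ (fun a => a = 0) _ (Mtf b) _ (f \o g); first by rewrite mul0r.
pose w (F : fieldType) i : HM F b := coef_homology R F (K b) n (h (delta_mx 0 i)).
have wE (F : fieldType) z : (coef_homology R F (K b) n (h z) : HM F b) = lincomb (w F) (map_mx intr z).
  have -> : h z = \sum_i z 0 i *: h (delta_mx 0 i).
    rewrite [z in LHS]matrix_sum_delta big_ord1 linear_sum.
    by apply: eq_bigr => i _; rewrite linearZ.
  apply: etrans (coef_sum _ _ _ _) _.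
  by apply: eq_bigr => i _; rewrite mxE.
have im_w (F : fieldType) u : exists z, Defs.pmap (HM F) ab u = lincomb (w F) z.
  have [s ->] := coef_span (@Htf a) u; elim: s => [|[k c] s [z IHs]].
    by exists 0; rewrite big_nil !linear0.
  have [k' kE] := gM k; exists (c *: map_mx intr (k' *m P) + z).
  rewrite big_cons !linearP IHs; congr (_ *: _ + _).
  apply: etrans (coef_homology_map _ _ _) _.
  by rewrite /= kE -wE -gP.
have w_im (F : fieldType) i : exists u, w F i = Defs.pmap (HM F) ab u.
  exists (coef_homology R F (K a) n (g (delta_mx 0 i *m Q))).
  by rewrite /w hQ; apply/esym; exact: coef_homology_map.
have w_rat c : lincomb (w rat) c = 0 -> c = 0.
  move=> c0; have [N [z [N0 zE]]] := clear_denominators c.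
  have hz : h z = 0 by apply: coef_rat_inj; rewrite wE -zE linearZ /= c0 scaler0.
  have z0 : z = 0 by apply/rowP => i; rewrite mxE; exact: h0.
  apply/eqP; move: zE; rewrite z0 map_mx0 => /eqP.
  by rewrite scaler_eq0 intr_eq0 (negbTE N0).
have rq : r = q.
  apply/eqP; rewrite eqn_leq; apply/andP; split.
    have [v [v_ind v_im _]] := rP rat.
    apply: (independent_leq_spanning v_ind (w := w rat)) => i.
    by have [u ->] := v_im i; exact: im_w.
  have [v [_ _ v_span]] := rP rat.
  apply: (independent_leq_spanning w_rat (w := v)) => i.
  by have [u ->] := w_im rat i; exact: v_span.
have [v [v_ind v_im _]] := rP 'F_p.
have w_ind : forall z, lincomb (w 'F_p) z = 0 -> z = 0.
  apply: (spanning_independent v_ind) rq => i.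
  by have [u ->] := v_im i; exact: im_w.
have [x0 x0E] := gM x.
have hxP : h (x0 *m P) = p%:Z *: y by rewrite -gP pyx x0E.
(* Reducing [h (x0 P) = p y] modulo [p] gives a relation among independent vectors, so every
   coordinate is divisible by [p]. *)
have dvd (i : 'I_q) : (p %| (x0 *m P)%R ord0 i)%Z.
  rewrite (dvdz_pcharf (pchar_Fp pp)).
  have /rowP/(_ i) : map_mx intr (x0 *m P) = 0 :> 'rV['F_p]_q.
    apply: w_ind; rewrite -wE hxP coefZ.
    suff -> : (p%:Z)%:~R = 0 :> 'F_p by rewrite scale0r.
    by apply/eqP; rewrite -(dvdz_pcharf (pchar_Fp pp)).
  by rewrite !mxE => ->.
exists (g ((\row_i ((x0 *m P)%R ord0 i %/ p)%Z) *m Q)).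
set z := \row_i _.
have pz : x0 *m P = p%:Z *: z.
  by apply/rowP => i; rewrite [RHS]mxE [z _ _]mxE mulrC divzK.
(* The target is torsion-free, so [p] can be cancelled. *)
have E : y = h z.
  have [|p0|/eqP] := Mtf b p%:Z (y - h z).
  - by rewrite scalerBr -linearZ -pz pyx x0E -gP subrr.
  - by move: p0 pp => [->].
  - by rewrite subr_eq0 => /eqP.
by rewrite E hQ.
Qed.
End Filtration.

Unset Implicit Arguments.
Set Strict Implicit.

(* When n = 0, H_{n-1} = 0 and the hypothesis on it is void. *)
Theorem theorem5p1 (R : realType) (d : Order.disp_t) (I : orderType d)
    (K : filtration I) (n : nat)
    (Hn_free : forall a : I, free_module (sing_homology R int (K a) n) /\
      finitely_generated (sing_homology R int (K a) n))
    (Hn1_free : forall m : nat, n = m.+1 ->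
      forall a : I, free_module (sing_homology R int (K a) m) /\
      finitely_generated (sing_homology R int (K a) m)) :
  (forall (F : fieldType) (a b : I) (ab : (a <= b)%O),
    [/\ forall h : sing_homology R int (K a) n,
          tensor_map F (sing_homology_map R int (incl_map K ab) n) (extend_scalars F h)
          = extend_scalars F (sing_homology_map R int (incl_map K ab) n h),
        forall t : tensor (sing_homology R int (K a) n) F,
          sing_homology_map R F (incl_map K ab) n (uct R F (K a) n t)
          = uct R F (K b) n (tensor_map F (sing_homology_map R int (incl_map K ab) n) t),
        bijective (uct R F (K a) n)
      & bijective (uct R F (K b) n)])
  /\
  [<-> (* 1 *) interval_decomposable (filtration_homology R K n int);
       (* 2 *) forall (a b : I) (ab : (a <= b)%O),
                 free_module (coker (sing_homology_map R int (incl_map K ab) n));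
       (* 3 *) forall (a b : I) (ab : (a <= b)%O),
                 free_module (relative_homology R int (incl_map K ab) n);
       (* 4 *) exists D : set I -> nat, forall F : fieldType,
                 persistence_diagram (filtration_homology R K n F) D].
Proof.
have Htf (a : I) (m : nat) : n = m.+1 -> torsion_free (sing_homology R int (K a) m).
  by move=> nm; apply: free_torsion_free (Hn1_free m nm a).1.
have Hfg a : finitely_generated (filtration_homology R K n int a) := (Hn_free a).2.
have Hfree a : fin_free (filtration_homology R K n int a).
  apply: torsion_free_fin_free (Hn_free a).2 _.
  exact: free_torsion_free (Hn_free a).1.
split=> [F a b ab|].
  split=> [h|t||]; [exact: tensor_liftE| |exact: uct_bij (Htf a)|exact: uct_bij (Htf b)].
  have [s ->] := tensorW t; rewrite !linear_sum; apply: eq_bigr => -[h x] _.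
  rewrite [tensor_map _ _ _]tensor_liftE [uct _ _ _ _ _]tensor_liftE.
  rewrite [RHS]tensor_liftE linearZ; congr (_ *: _); exact: coef_homology_map.
have cokP (a b : I) (ab : (a <= b)%O) :
    free_module (coker (sing_homology_map R int (incl_map K ab) n)) <->
    saturated (sing_homology_map R int (incl_map K ab) n).
  exact: coker_free (Hfg b).
have relP (a b : I) (ab : (a <= b)%O) :
    free_module (relative_homology R int (incl_map K ab) n) <->
    saturated (sing_homology_map R int (incl_map K ab) n).
  apply: relative_free (Hfg b) _ => [|m nm].
    exact/singular_map_inj/incl_inj.
  split; [exact: (Hn1_free m nm a).2 | exact: Htf | exact: Htf].
have based_dec : (forall (a b : I) (ab : (a <= b)%O),
    saturated (sing_homology_map R int (incl_map K ab) n)) ->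
    exists (L : choiceType) (J : L -> set I)
      (e : forall (l : L) a, filtration_homology R K n int a), based_family J e.
  exact: (@saturated_based _ _ (filtration_homology R K n int) Hfree).
have dec_sat : interval_decomposable (filtration_homology R K n int) ->
    forall (a b : I) (ab : (a <= b)%O),
      saturated (sing_homology_map R int (incl_map K ab) n).
  move=> [L [N [J NJ]]] a b ab; have [e eP] := decomposition_based NJ.
  exact: based_saturated eP a b ab.
(* The implications run in the cycle from (1) to (2), (3), (4) and back, each through saturation of
   the maps. *)
tfae.
- by move=> dec a b ab; apply/cokP/dec_sat.
- by move=> ck a b ab; apply/relP/cokP.
- move=> rl; have [|L [J [e eP]]] := based_dec; first by move=> a b ab; apply/relP/rl.
  exact: (based_persistence_diagram Htf Hfg eP).
- move=> [D DP]; have [|L [J [e eP]]] := based_dec.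
    by move=> a b ab; exact: (diagram_saturated Htf Hfree DP).
  have [N NJ] := based_decomposition eP.
  by exists L, N, J.
Qed.
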